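(* Let $b>0$ and let $f\in C^2[-b,b]$ be complex-valued with $f(x)\ne0$ on $[-b,b]$ and $f(0)=1$. Let $\mathbf{R}=(-b,b)\times(-b,b)$, let $w$ be a hyperbolic analytic function in $\mathbf{R}$ (a $\mathbb{B}$-valued continuously differentiable solution of $\partial_{\bar z}w=0$), and let $W=\mathbf{V}_1w$ be the corresponding solution of $\partial_{\bar z}W-\frac{\partial_{\bar z}f}{f}\overline W=0$, where $\mathbf{V}_1=T_f\mathcal{R}+\mathbf{j}T_{1/f}\mathcal{I}$ and $\mathbf{V}_2=T_{1/f}\mathcal{R}+\mathbf{j}T_f\mathcal{I}$. Then whenever the corresponding derivative (with respect to $z$) of $w$ exists there exists a derivative of the same order in the sense of Bers of the function $W$, and vice versa, and the following relations are valid: $$\mathbf{V}_1\bigl(\partial_z^{2n}w\bigr)=W^{[2n]}\qquad\text{and}\qquad\mathbf{V}_2\bigl(\partial_z^{2n-1}w\bigr)=W^{[2n-1]},\qquad n=1,2,\ldots.$$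
   Context: $\mathbb{B}=\{w=u+v\mathbf{j}:u,v\in\mathbb{C}\}$ is the commutative algebra of bicomplex numbers, $\mathbf{j}^2=1$, the complex unit commuting with $\mathbf{j}$; $\overline w=u-v\mathbf{j}$, $\mathcal{R}(w)=u$, $\mathcal{I}(w)=v$. ''Scalar'' means $\mathbb{C}$-valued. $z=x+t\mathbf{j}$ with $x,t\in\mathbb{R}$; $\partial_z=\frac12(\partial_x+\mathbf{j}\partial_t)$, $\partial_{\bar z}=\frac12(\partial_x-\mathbf{j}\partial_t)$; $f=f(x)$ is regarded as a function of $(x,t)$, so $\partial_{\bar z}f=f'(x)/2$. Operators. For a complex-valued $q\in C[-b,b]$ and $h\in\mathbb{C}$, let $\mathbf{H}(u,v;h)$ be the unique solution, on $\{|u|\le b,|v|\le b,|u+v|\le b\}$, of $$\frac{\partial^2\mathbf{H}}{\partial u\,\partial v}=q(u+v)\mathbf{H},\qquad \mathbf{H}(u,0;h)=\frac h2+\frac12\int_0^uq(s)\,ds,\qquad \mathbf{H}(0,v;h)=\frac h2,$$ $\mathbf{K}(x,t;h)=\mathbf{H}(\frac{x+t}2,\frac{x-t}2;h)$ and $\mathbf{T}_hg(x)=g(x)+\int_{-x}^x\mathbf{K}(x,s;h)g(s)\,ds$. $T_f$ is $\mathbf{T}_h$ for $q=q_f:=f''/f$, $h=f'(0)$; $T_{1/f}$ is $\mathbf{T}_h$ for $q=q_{1/f}:=-q_f+2(f'/f)^2$, $h=-f'(0)$. On functions of $(x,t)$ they act in the variable $x$ for each fixed $t$. Bers derivatives: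 put $(F_n,G_n)=(f,\mathbf{j}/f)$ for even $n$ and $(F_n,G_n)=(1/f,\mathbf{j}f)$ for odd $n$. Set $W^{[0]}=W$; writing $W^{[n]}=\varphi F_n+\psi G_n$ with (unique) scalar functions $\varphi,\psi$, define $W^{[n+1]}=(\partial_z\varphi)F_n+(\partial_z\psi)G_n$. *)

(* Defs.v *)
From Stdlib Require Import Reals.
From Coquelicot Require Export Coquelicot.

Open Scope R_scope.

(** * C as a complete normed space over R *)

(* Coquelicot only declares C complete over itself; [RInt] and derivatives in a
   real variable need the structure over R. *)
Definition C_R_CompleteNormedModule : CompleteNormedModule R_AbsRing :=
  CompleteNormedModule.Pack R_AbsRing C
    (CompleteNormedModule.Class R_AbsRing C
       (NormedModule.class R_AbsRing C_R_NormedModule)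
       C_CompleteSpace_mixin) C.

Definition CRInt (g : R -> C) (a c : R) : C :=
  RInt (V := C_R_CompleteNormedModule) g a c.

(** * Bicomplex numbers *)

(* The pair (u, v) stands for u + v j, where j^2 = 1. *)
Definition B : Type := (C * C)%type.

Definition B_NormedModule : NormedModule R_AbsRing :=
  prod_NormedModule R_AbsRing C_R_NormedModule C_R_NormedModule.

Definition scalar (u : C) : B := (u, RtoC 0).
Definition Bj : B := (RtoC 0, RtoC 1).
Definition scalar_part (w : B) : C := fst w.
Definition j_part (w : B) : C := snd w.

Definition Bplus (w1 w2 : B) : B :=
  (Cplus (fst w1) (fst w2), Cplus (snd w1) (snd w2)).
Definition Bopp (w : B) : B := (Copp (fst w), Copp (snd w)).
Definition Bmult (w1 w2 : B) : B :=
  (Cplus (Cmult (fst w1) (fst w2)) (Cmult (snd w1) (snd w2)),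
   Cplus (Cmult (fst w1) (snd w2)) (Cmult (snd w1) (fst w2))).
Definition Bconj (w : B) : B := (fst w, Copp (snd w)).

Declare Scope B_scope.
Delimit Scope B_scope with B.
Bind Scope B_scope with B.
Infix "+" := Bplus : B_scope.
Infix "*" := Bmult : B_scope.
Notation "- w" := (Bopp w) : B_scope.
Notation "w1 - w2" := (Bplus w1 (Bopp w2)) : B_scope.

(** * Regularity of f on the closed interval *)

Definition segment (b x : R) : Prop := -b <= x <= b.

(* [is_derive] with the neighbourhood filter restricted to [D]; one-sided at an
   endpoint of an interval. *)
Definition is_derive_in (D : R -> Prop) (g : R -> C) (x : R) (l : C) : Prop :=
  filterdiff (K := R_AbsRing) (U := R_NormedModule) (V := C_R_NormedModule)
    g (within D (locally x)) (fun y => scal y l).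

(* f is in C^2[-b,b], with f' = f1 and f'' = f2. *)
Definition C2_segment (b : R) (f f1 f2 : R -> C) : Prop :=
  (forall x, segment b x -> is_derive_in (segment b) f x (f1 x)) /\
  (forall x, segment b x -> is_derive_in (segment b) f1 x (f2 x)) /\
  continuous_on (T := R_UniformSpace) (U := C_UniformSpace) (segment b) f2.

(** * Transmutation operators *)

Definition goursat_domain (b u v : R) : Prop :=
  Rabs u <= b /\ Rabs v <= b /\ Rabs (u + v) <= b.

Definition goursat_interior (b u v : R) : Prop :=
  Rabs u < b /\ Rabs v < b /\ Rabs (u + v) < b.

(* Continuity up to the boundary and the equation in the interior already
   determine H uniquely on the closed domain when q is continuous on [-b,b];
   no further regularity is imposed. *)
Definition is_goursat_solution (b : R) (q : R -> C) (h : C)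
    (H : R -> R -> C) : Prop :=
  continuous_on (T := prod_UniformSpace R_UniformSpace R_UniformSpace)
    (U := C_UniformSpace)
    (fun p => goursat_domain b (fst p) (snd p)) (fun p => H (fst p) (snd p)) /\
  (exists Hv : R -> R -> C, forall u v, goursat_interior b u v ->
     is_derive (K := R_AbsRing) (V := C_R_NormedModule)
       (fun y => H u y) v (Hv u v) /\
     is_derive (K := R_AbsRing) (V := C_R_NormedModule)
       (fun y => Hv y v) u (Cmult (q (u + v)) (H u v))) /\
  (forall u, segment b u ->
     H u 0 = Cplus (Cdiv h (RtoC 2)) (Cdiv (CRInt q 0 u) (RtoC 2))) /\
  (forall v, segment b v -> H 0 v = Cdiv h (RtoC 2)).

(* H is the solution of the Goursat problem, from which the kernel
   K(x,t) = H((x+t)/2, (x-t)/2) is built. *)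
Definition transmutation (H : R -> R -> C) (g : R -> C) (x : R) : C :=
  Cplus (g x)
    (CRInt (fun s => Cmult (H ((x + s) / 2) ((x - s) / 2)) (g s)) (- x) x).

Definition q_f (f f2 : R -> C) (x : R) : C := Cdiv (f2 x) (f x).

Definition q_inv_f (f f1 f2 : R -> C) (x : R) : C :=
  Cplus (Copp (q_f f f2 x))
    (Cmult (RtoC 2) (Cmult (Cdiv (f1 x) (f x)) (Cdiv (f1 x) (f x)))).

(* (T_1 R + j T_2 I) w, where T_i is the transmutation with Goursat solution Hi,
   acting in x for fixed t. *)
Definition V_op (H1 H2 : R -> R -> C) (w : R -> R -> B) (x t : R) : B :=
  (scalar (transmutation H1 (fun s => scalar_part (w s t)) x)
   + Bj * scalar (transmutation H2 (fun s => j_part (w s t)) x))%B.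

(** * Derivatives on the open square *)

Definition square (b x t : R) : Prop := -b < x < b /\ -b < t < b.

(* w is continuously differentiable on the open square, with partial
   derivatives wx and wt. *)
Definition C1_square (b : R) (w wx wt : R -> R -> B) : Prop :=
  (forall x t, square b x t ->
     is_derive (K := R_AbsRing) (V := B_NormedModule)
       (fun y => w y t) x (wx x t) /\
     is_derive (K := R_AbsRing) (V := B_NormedModule)
       (fun y => w x y) t (wt x t)) /\
  continuous_on (T := prod_UniformSpace R_UniformSpace R_UniformSpace)
    (U := B_NormedModule)
    (fun p => square b (fst p) (snd p)) (fun p => wx (fst p) (snd p)) /\
  continuous_on (T := prod_UniformSpace R_UniformSpace R_UniformSpace)
    (U := B_NormedModule)
    (fun p => square b (fst p) (snd p)) (fun p => wt (fst p) (snd p)).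

Definition Bhalf : B := scalar (Cinv (RtoC 2)).

(* A derivative is said to exist when the differentiated function is C^1:
   with mere partial differentiability it need not be integrable, and the
   operators above would not apply to it. *)
Definition is_dz (b : R) (w w' : R -> R -> B) : Prop :=
  exists wx wt, C1_square b w wx wt /\
    forall x t, square b x t -> w' x t = (Bhalf * (wx x t + Bj * wt x t))%B.

Definition is_dzbar (b : R) (w w' : R -> R -> B) : Prop :=
  exists wx wt, C1_square b w wx wt /\
    forall x t, square b x t -> w' x t = (Bhalf * (wx x t - Bj * wt x t))%B.

Definition hyperbolic_analytic (b : R) (w : R -> R -> B) : Prop :=
  is_dzbar b w (fun _ _ => scalar (RtoC 0)).

(* f depends on x only, so its derivative in zbar is f1 x / 2. *)
Definition vekua_solution (b : R) (f f1 : R -> C) (W : R -> R -> B) : Prop :=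
  exists W', is_dzbar b W W' /\
    forall x t, square b x t ->
      (W' x t - scalar (Cdiv (Cdiv (f1 x) (RtoC 2)) (f x)) * Bconj (W x t))%B
      = scalar (RtoC 0).

Fixpoint is_dz_n (b : R) (n : nat) (w wn : R -> R -> B) : Prop :=
  match n with
  | O => forall x t, square b x t -> wn x t = w x t
  | S m => exists v, is_dz_n b m w v /\ is_dz b v wn
  end.

(** * Bers derivatives *)

Definition F_ (f : R -> C) (n : nat) (x : R) : B :=
  if Nat.even n then scalar (f x) else scalar (Cinv (f x)).

Definition G_ (f : R -> C) (n : nat) (x : R) : B :=
  if Nat.even n then (Bj * scalar (Cinv (f x)))%B else (Bj * scalar (f x))%B.

(* The step from W^[n] = phi F_n + psi G_n to W^[n+1]. *)
Definition is_bers_step (b : R) (f : R -> C) (n : nat)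
    (W W' : R -> R -> B) : Prop :=
  exists (phi psi : R -> R -> C) (phiz psiz : R -> R -> B),
    (forall x t, square b x t ->
       W x t = (scalar (phi x t) * F_ f n x + scalar (psi x t) * G_ f n x)%B) /\
    is_dz b (fun x t => scalar (phi x t)) phiz /\
    is_dz b (fun x t => scalar (psi x t)) psiz /\
    (forall x t, square b x t ->
       W' x t = (phiz x t * F_ f n x + psiz x t * G_ f n x)%B).

Fixpoint is_bers_n (b : R) (f : R -> C) (n : nat)
    (W Wn : R -> R -> B) : Prop :=
  match n with
  | O => forall x t, square b x t -> Wn x t = W x t
  | S m => exists V, is_bers_n b f m W V /\ is_bers_step b f m V Wn
  end.

(* Main.v *)
Require Import Defs.
From Stdlib Require Import Reals Lra Lia ClassicalEpsilon.
From Coquelicot Require Import Coquelicot.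

(** The transmutation operators carry plain differentiation to the first-order factors
    of two Schroedinger operators, and Bers differentiation is made of exactly these
    factors.  Put a = f'/f.  The two potentials are q = a' + a^2 and
    p = a^2 - a', that is d^2 - q = (d + a)(d - a) and d^2 - p = (d - a)(d + a) with
    d = d/dx.  Writing T_H and T_M for the transmutations built from q and p, the
    heart of the matter is the pair of commutation relations
      (d - a) T_H g = T_M g'     and     (d + a) T_M g = T_H g'
    for every C^1 function g ([is_deriveC_transmutation]; the second relation is the
    first one for -a).  After an integration by parts they say that the Goursat
    solutions H and M satisfy the first-order system
      (H + M)_u = a(u+v) (H - M),      (H - M)_v = a(u+v) (H + M).
    Its two defects P, Q solve P_v = - a Q, Q_u = - a P with zero data on the axes,
    hence vanish by a Volterra estimate ([darboux_kernel_system]).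

    A hyperbolic analytic w = u + v j satisfies u_x = v_t and v_x = u_t, and
    its z-derivative is w_x.  For W = U + V j = T_H u + j T_M v the commutation
    relations read U_x - a U = T_M u_x = V_t and V_x + a V = T_H v_x = U_t: this is
    the Vekua equation, and the coefficients phi = U/f, psi = f V of W in the pair
    (f, j/f) give W^[1] = T_M u_x + j T_H v_x, the operator with exchanged kernels
    applied to the z-derivative of w ([generating_step_iff]).  The next step is the
    same statement for 1/f, for which a becomes -a and the kernels are exchanged;
    induction on the order follows ([dz_bers_correspondence]).

    For the induction two facts about regularity are needed.  First, the z-derivative
    of w must again be of the same kind, although it is merely continuous until one
    more derivative is assumed.  This is why w is written as a pair of travelling
    waves, u + v = 2 P(x+t) and u - v = 2 Q(x-t): differentiation in z is
    differentiation of the profiles P and Q, and one x-derivative of w already makes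
    both profiles C^1 ([wave_C1_profile]).  Second, if a Bers derivative exists one
    more time then so does the z-derivative.  Since H has continuous first
    derivatives, the integral term of T_H g is differentiable in x for a continuous g,
    so that g inherits an x-derivative from T_H g ([derive_x_of_transmutation]), and
    the profiles do the rest. *)

Notation is_deriveC := (is_derive (K := R_AbsRing) (V := C_R_NormedModule)).
Notation continuousC := (continuous (U := C_UniformSpace)).
Notation continuousC2 :=
  (continuous (T := prod_UniformSpace _ R_UniformSpace) (U := C_UniformSpace)).

Notation R2 := (prod_UniformSpace R_UniformSpace R_UniformSpace).

(* The same carrier appears under several canonical structures; [ring] and [field]
   need the equation to be stated at C or at R itself. *)
Ltac C_eq := match goal with |- @eq _ ?x ?y => change (@eq C x y) end; cbv beta.
Ltac R_eq := match goal with |- @eq _ ?x ?y => change (@eq R x y) end; cbv beta.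

(** * Calculus of C-valued functions of real variables *)

Lemma is_derive_pair_iff (V1 V2 : NormedModule R_AbsRing)
  (g : R -> V1 * V2) (x : R) (l : V1 * V2) :
  is_derive (K := R_AbsRing) (V := prod_NormedModule R_AbsRing V1 V2) g x l <->
  is_derive (K := R_AbsRing) (V := V1) (fun y => fst (g y)) x (fst l) /\
  is_derive (K := R_AbsRing) (V := V2) (fun y => snd (g y)) x (snd l).
Proof.
  split.
  - intros H; split.
    + apply (filterdiff_comp' (U := R_NormedModule)
        (V := prod_NormedModule R_AbsRing V1 V2) (W := V1)
        g fst x (fun y => scal y l) fst H).
      apply filterdiff_linear, is_linear_fst.
    + apply (filterdiff_comp' (U := R_NormedModule)
        (V := prod_NormedModule R_AbsRing V1 V2) (W := V2)
        g snd x (fun y => scal y l) snd H).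
      apply filterdiff_linear, is_linear_snd.
  - intros [H1 H2].
    assert (H := filterdiff_comp'_2 (T := R_NormedModule) (U := V1) (V := V2)
      (W := prod_NormedModule R_AbsRing V1 V2)
      (fun y => fst (g y)) (fun y => snd (g y)) (fun u v => (u, v)) x _ _
      (fun u v => (u, v)) H1 H2).
    eapply filterdiff_ext; [ | eapply filterdiff_ext_lin; [ apply H | ] ].
    + intros y; simpl; destruct (g y); reflexivity.
    + apply (filterdiff_ext (U := prod_NormedModule R_AbsRing V1 V2)
        (V := prod_NormedModule R_AbsRing V1 V2) (fun t => t)).
      { intros [y1 y2]; reflexivity. }
      eapply filterdiff_ext_lin; [ apply filterdiff_id | ].
      intros [y1 y2]; reflexivity.
    + intros y; reflexivity.
Qed.

Lemma is_derive_C_iff (g : R -> C) (x : R) (l : C) :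
  is_deriveC g x l <->
  is_derive (fun y => Re (g y)) x (Re l) /\ is_derive (fun y => Im (g y)) x (Im l).
Proof. exact (is_derive_pair_iff R_NormedModule R_NormedModule g x l). Qed.

Lemma is_derive_B_iff (g : R -> B) (x : R) (l : B) :
  is_derive (K := R_AbsRing) (V := B_NormedModule) g x l <->
  is_deriveC (fun y => fst (g y)) x (fst l) /\
  is_deriveC (fun y => snd (g y)) x (snd l).
Proof. exact (is_derive_pair_iff C_R_NormedModule C_R_NormedModule g x l). Qed.

Lemma filterlim_pair_iff {T : Type} {U V : UniformSpace} (F : (T -> Prop) -> Prop)
  {FF : Filter F} (g : T -> U * V) (l : U * V) :
  filterlim g F (locally (T := prod_UniformSpace U V) l) <->
  filterlim (fun y => fst (g y)) F (locally (fst l)) /\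
  filterlim (fun y => snd (g y)) F (locally (snd l)).
Proof.
  split.
  - intros H; split.
    + apply (filterlim_comp _ _ _ g fst _ _ _ H).
      destruct l; apply continuous_fst.
    + apply (filterlim_comp _ _ _ g snd _ _ _ H).
      destruct l; apply continuous_snd.
  - intros [H1 H2].
    assert (H := filterlim_pair _ _ H1 H2).
    intros P [e He].
    assert (HP : filter_prod (locally (fst l)) (locally (snd l)) P).
    { exists (ball (fst l) e) (ball (snd l) e); try apply locally_ball.
      intros u v Hu Hv; apply He; split; assumption. }
    generalize (H P HP). unfold filtermap.
    apply filter_imp. intros y; destruct (g y); trivial.
Qed.

Lemma continuous_C_iff {T : UniformSpace} (g : T -> C) (x : T) :
  continuousC g x <->
  continuous (fun y => Re (g y)) x /\ continuous (fun y => Im (g y)) x.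
Proof.
  exact (filterlim_pair_iff (U := R_UniformSpace) (V := R_UniformSpace)
    (locally x) g (g x)).
Qed.

Section ContinuousC.
Context {T : UniformSpace} (x : T).

Lemma continuousC_const (c : C) : continuousC (fun _ : T => c) x.
Proof. apply continuous_const. Qed.

Lemma continuousC_plus (g1 g2 : T -> C) :
  continuousC g1 x -> continuousC g2 x ->
  continuousC (fun y => Cplus (g1 y) (g2 y)) x.
Proof.
  rewrite !continuous_C_iff; intros [H1 H2] [H3 H4]; split; simpl;
    apply (continuous_plus (V := R_NormedModule)); assumption.
Qed.

Lemma continuousC_opp (g : T -> C) :
  continuousC g x -> continuousC (fun y => Copp (g y)) x.
Proof.
  rewrite !continuous_C_iff; intros [H1 H2]; split; simpl;
    apply (continuous_opp (V := R_NormedModule)); assumption.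
Qed.

Lemma continuousC_minus (g1 g2 : T -> C) :
  continuousC g1 x -> continuousC g2 x ->
  continuousC (fun y => Cminus (g1 y) (g2 y)) x.
Proof.
  intros; apply continuousC_plus; [ | apply continuousC_opp]; assumption.
Qed.

Lemma continuousC_mult (g1 g2 : T -> C) :
  continuousC g1 x -> continuousC g2 x ->
  continuousC (fun y => Cmult (g1 y) (g2 y)) x.
Proof.
  rewrite !continuous_C_iff; intros [H1 H2] [H3 H4]; split; simpl.
  - apply (continuous_minus (V := R_NormedModule));
      apply (continuous_mult (K := R_AbsRing)); assumption.
  - apply (continuous_plus (V := R_NormedModule));
      apply (continuous_mult (K := R_AbsRing)); assumption.
Qed.

Lemma continuousC_RtoC (g : T -> R) :
  continuous g x -> continuousC (fun y => RtoC (g y)) x.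
Proof.
  rewrite !continuous_C_iff; intros H; split; simpl; trivial.
  apply continuous_const.
Qed.

Lemma continuousC_comp {S : UniformSpace} (g : T -> S) (h : S -> C) :
  continuous g x -> continuousC h (g x) -> continuousC (fun y => h (g y)) x.
Proof. intros H1 H2; apply (continuous_comp g h); assumption. Qed.

Lemma continuous_pair {U V : UniformSpace} (g1 : T -> U) (g2 : T -> V) :
  continuous g1 x -> continuous g2 x ->
  continuous (U := prod_UniformSpace U V) (fun y => (g1 y, g2 y)) x.
Proof.
  intros H1 H2.
  apply (filterlim_pair_iff (locally x) (fun y => (g1 y, g2 y)) (g1 x, g2 x)).
  split; assumption.
Qed.

End ContinuousC.

Lemma is_deriveC_const (c : C) (x : R) : is_deriveC (fun _ => c) x (RtoC 0).
Proof. exact (is_derive_const (V := C_R_NormedModule) c x). Qed.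

Lemma is_deriveC_plus (g1 g2 : R -> C) (x : R) (l1 l2 : C) :
  is_deriveC g1 x l1 -> is_deriveC g2 x l2 ->
  is_deriveC (fun y => Cplus (g1 y) (g2 y)) x (Cplus l1 l2).
Proof. exact (is_derive_plus (V := C_R_NormedModule) g1 g2 x l1 l2). Qed.

Lemma is_deriveC_minus (g1 g2 : R -> C) (x : R) (l1 l2 : C) :
  is_deriveC g1 x l1 -> is_deriveC g2 x l2 ->
  is_deriveC (fun y => Cminus (g1 y) (g2 y)) x (Cminus l1 l2).
Proof. exact (is_derive_minus (V := C_R_NormedModule) g1 g2 x l1 l2). Qed.

Lemma is_deriveC_mult (g1 g2 : R -> C) (x : R) (l1 l2 : C) :
  is_deriveC g1 x l1 -> is_deriveC g2 x l2 ->
  is_deriveC (fun y => Cmult (g1 y) (g2 y)) x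
    (Cplus (Cmult l1 (g2 x)) (Cmult (g1 x) l2)).
Proof.
  rewrite !is_derive_C_iff; intros [H1 H2] [H3 H4].
  split; simpl.
  - evar_last.
    + apply (is_derive_minus (V := R_NormedModule));
        apply (is_derive_mult (K := R_AbsRing));
        try eassumption; intros; apply Rmult_comm.
    + unfold minus, plus, opp, mult; simpl. unfold Re, Im; ring.
  - evar_last.
    + apply (is_derive_plus (V := R_NormedModule));
        apply (is_derive_mult (K := R_AbsRing));
        try eassumption; intros; apply Rmult_comm.
    + unfold minus, plus, opp, mult; simpl. unfold Re, Im; ring.
Qed.

Lemma is_deriveC_comp (g : R -> C) (r : R -> R) (x dr : R) (l : C) :
  is_deriveC g (r x) l -> is_derive r x dr ->
  is_deriveC (fun y => g (r y)) x (Cmult (RtoC dr) l).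
Proof.
  intros H1 H2. evar_last.
  - apply (is_derive_comp (V := C_R_NormedModule) g r x l dr H1 H2).
  - change (@eq C (dr * fst l, dr * snd l) (Cmult (RtoC dr) l)).
    unfold Cmult, RtoC; simpl. f_equal; ring.
Qed.

Lemma is_deriveC_continuous (g : R -> C) (x : R) (l : C) :
  is_deriveC g x l -> continuousC g x.
Proof.
  intros H.
  apply (ex_derive_continuous (K := R_AbsRing) (V := C_R_NormedModule) g x).
  exists l; exact H.
Qed.

Lemma is_deriveC_inv (g : R -> C) (x : R) (l : C) :
  is_deriveC g x l -> g x <> RtoC 0 ->
  is_deriveC (fun y => Cinv (g y)) x (Copp (Cdiv l (Cmult (g x) (g x)))).
Proof.
  rewrite !is_derive_C_iff; intros [H1 H2] H0.
  assert (Hn : Re (g x) * Re (g x) + Im (g x) * Im (g x) <> 0).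
  { intros E. apply H0. 
    assert (Re (g x) = 0) by nra. assert (Im (g x) = 0) by nra.
    destruct (g x) as [u v]; simpl in *; subst; reflexivity. }
  assert (HN : is_derive (fun y => Re (g y) ^ 2 + Im (g y) ^ 2) x
    (2 * Re l * Re (g x) + 2 * Im l * Im (g x))).
  { evar_last.
    - apply (is_derive_plus (V := R_NormedModule)); apply is_derive_pow; eassumption.
    - unfold plus; simpl; ring. }
  assert (Hn' : Re (g x) ^ 2 + Im (g x) ^ 2 <> 0) by (intros E; apply Hn; simpl in E; lra).
  split; unfold Cinv; simpl.
  - evar_last; [ apply is_derive_div; eassumption | ].
    unfold Re, Im in *. destruct (g x) as [u v], l as [l1 l2]; simpl in *.
    field; repeat split; nra.
  - evar_last.
    { apply is_derive_div; [apply (is_derive_opp (V := R_NormedModule)); eassumption | eassumption | assumption]. }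
    unfold opp; simpl.
    unfold Re, Im in *. destruct (g x) as [u v], l as [l1 l2]; simpl in *.
    field; repeat split; nra.
Qed.

Lemma CRInt_pair (g : R -> C) (a c : R) :
  ex_RInt (V := C_R_NormedModule) g a c ->
  CRInt g a c = (RInt (fun s => Re (g s)) a c, RInt (fun s => Im (g s)) a c).
Proof.
  intros [l Hl]. unfold CRInt.
  transitivity l; [exact (is_RInt_unique (V := C_R_CompleteNormedModule) g a c l Hl) | ].
  symmetry; apply (RInt_fct_extend_pair (U := R_NormedModule) (V := R_NormedModule) (fun g a c => RInt g a c) (fun g a c => RInt g a c)).
  - intros; apply is_RInt_unique; assumption.
  - intros; apply is_RInt_unique; assumption.
  - exact Hl.
Qed.

Lemma ex_CRInt_continuous (g : R -> C) (a c : R) :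
  (forall s, Rmin a c <= s <= Rmax a c -> continuousC g s) ->
  ex_RInt (V := C_R_CompleteNormedModule) g a c.
Proof. exact (ex_RInt_continuous (V := C_R_CompleteNormedModule) g a c). Qed.

Lemma CRInt_derive (g dg : R -> C) (a c : R) :
  (forall s, Rmin a c <= s <= Rmax a c -> is_deriveC g s (dg s)) ->
  (forall s, Rmin a c <= s <= Rmax a c -> continuousC dg s) ->
  CRInt dg a c = Cminus (g c) (g a).
Proof.
  intros H1 H2. unfold CRInt.
  apply (is_RInt_unique (V := C_R_CompleteNormedModule) dg a c).
  exact (is_RInt_derive (V := C_R_CompleteNormedModule) g dg a c H1 H2).
Qed.
(** * Integrals depending on a parameter *)

(** Compactness of [0,1] makes continuity at the points (p0, s) uniform in s; this is
    what lets a limit in the parameter pass through the integral. *)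
Lemma locally_forall_unit_interval {T : UniformSpace} (phi : T -> R -> R) (p0 : T)
  (e : posreal) :
  (forall s, 0 <= s <= 1 ->
     continuous (T := prod_UniformSpace T R_UniformSpace)
       (fun z => phi (fst z) (snd z)) (p0, s)) ->
  locally p0 (fun p => forall s, 0 <= s <= 1 -> Rabs (phi p s - phi p0 s) <= e).
Proof.
  intros Hc.
  assert (Hd : forall s, exists d : posreal, 0 <= s <= 1 ->
    forall p s', ball p0 d p -> ball s d s' ->
      Rabs (phi p s' - phi p0 s) < pos_div_2 e).
  { intros s. destruct (excluded_middle_informative (0 <= s <= 1)) as [Hs | Hs].
    - destruct (proj1 (filterlim_locally (fun z => phi (fst z) (snd z)) _)
        (Hc s Hs) (pos_div_2 e)) as [d Hd].
      exists d; intros _ p s' Hp Hs'.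
      apply (Hd (p, s')); split; assumption.
    - exists (mkposreal 1 Rlt_0_1); tauto. }
  set (delta := fun s => proj1_sig (constructive_indefinite_description _ (Hd s))).
  assert (Hdelta : forall s, 0 <= s <= 1 ->
    forall p s', ball p0 (delta s) p -> ball s (delta s) s' ->
      Rabs (phi p s' - phi p0 s) < pos_div_2 e).
  { intros s; unfold delta.
    destruct (constructive_indefinite_description _ (Hd s)); simpl; assumption. }
  destruct (compactness_value_1d 0 1 delta) as [d0 H0].
  exists d0; intros p Hp s Hs.
  destruct (NNPP _ (H0 s Hs)) as [s0 [Hs0 [Hss0 Hds0]]].
  assert (Hb : ball s0 (delta s0) s) by exact Hss0.
  assert (H1 := Hdelta s0 Hs0 p s (ball_le _ _ _ Hds0 _ Hp) Hb).
  assert (H2 := Hdelta s0 Hs0 p0 s (ball_center _ _) Hb).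
  simpl in H1, H2.
  replace (phi p s - phi p0 s)
    with ((phi p s - phi p0 s0) - (phi p0 s - phi p0 s0)) by ring.
  eapply Rle_trans; [ apply Rabs_triang | ]. rewrite Rabs_Ropp. lra.
Qed.

Lemma continuous_slice {T : UniformSpace} {V : UniformSpace} (phi : T -> R -> V) (p : T) (s : R) :
  continuous (T := prod_UniformSpace T R_UniformSpace)
    (fun z => phi (fst z) (snd z)) (p, s) ->
  continuous (phi p) s.
Proof.
  intros H.
  apply (continuous_comp (V := prod_UniformSpace T R_UniformSpace)
    (fun s' => (p, s')) (fun z => phi (fst z) (snd z))); trivial.
  apply continuous_pair; [apply continuous_const | apply continuous_id].
Qed.

Lemma continuous_RInt_unit {T : UniformSpace} (phi : T -> R -> R) (p0 : T) :
  locally p0 (fun p => forall s, 0 <= s <= 1 ->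
     continuous (T := prod_UniformSpace T R_UniformSpace)
       (fun z => phi (fst z) (snd z)) (p, s)) ->
  continuous (fun p => RInt (phi p) 0 1) p0.
Proof.
  intros Hl.
  assert (Hex : forall p, (forall s, 0 <= s <= 1 ->
     continuous (T := prod_UniformSpace T R_UniformSpace)
       (fun z => phi (fst z) (snd z)) (p, s)) -> ex_RInt (phi p) 0 1).
  { intros p Hp. apply (ex_RInt_continuous (V := R_CompleteNormedModule)).
    rewrite Rmin_left, Rmax_right by lra.
    intros s Hs; apply continuous_slice, Hp, Hs. }
  assert (H0 := locally_singleton _ _ Hl).
  apply filterlim_locally. intros e.
  generalize (filter_and _ _ Hl (locally_forall_unit_interval phi p0 (pos_div_2 e) H0)).
  apply filter_imp. intros p [Hp1 Hp2].
  change (Rabs (RInt (phi p) 0 1 - RInt (phi p0) 0 1) < e).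
  assert (E := RInt_minus (V := R_CompleteNormedModule) _ _ 0 1 (Hex p Hp1) (Hex p0 H0)).
  change (RInt (fun x => phi p x - phi p0 x) 0 1
    = RInt (phi p) 0 1 - RInt (phi p0) 0 1) in E.
  rewrite <- E.
  eapply Rle_lt_trans.
  - apply (abs_RInt_le_const _ 0 1 (pos_div_2 e)); [lra | | exact Hp2].
    apply (ex_RInt_minus (V := R_NormedModule)); auto.
  - simpl. destruct e; simpl; lra.
Qed.

Lemma continuous_CRInt_unit {T : UniformSpace} (phi : T -> R -> C) (p0 : T) :
  locally p0 (fun p => forall s, 0 <= s <= 1 ->
     continuousC2
       (fun z => phi (fst z) (snd z)) (p, s)) ->
  continuousC (fun p => CRInt (phi p) 0 1) p0.
Proof.
  intros Hl.
  apply (continuous_ext_loc _ (fun p => 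
    (RInt (fun s => Re (phi p s)) 0 1, RInt (fun s => Im (phi p s)) 0 1))).
  { revert Hl; apply filter_imp; intros p Hp. symmetry; apply CRInt_pair.
    apply ex_CRInt_continuous. rewrite Rmin_left, Rmax_right by lra.
    intros s Hs; apply continuous_slice, Hp, Hs. }
  apply continuous_C_iff; split; simpl; apply continuous_RInt_unit;
    revert Hl; apply filter_imp; intros p Hp s Hs;
    specialize (Hp s Hs); apply continuous_C_iff in Hp; tauto.
Qed.

Definition segment_point (a c s : R) : R := a + (c - a) * s.

(** Moving end points become parameters of the integrand, so that the fixed interval
    [0,1] covers every integral needed below. *)
Lemma CRInt_unit (g : R -> C) (a c : R) :
  (forall s, Rmin a c <= s <= Rmax a c -> continuousC g s) ->
  CRInt g a c =
  Cmult (RtoC (c - a)) (CRInt (fun s => g (segment_point a c s)) 0 1).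
Proof.
  intros Hg.
  assert (Hex := ex_CRInt_continuous g a c Hg).
  unfold segment_point.
  replace (CRInt g a c) with (CRInt g ((c - a) * 0 + a) ((c - a) * 1 + a)) by (f_equal; ring).
  assert (Hex' : ex_RInt (V := C_R_CompleteNormedModule) g ((c - a) * 0 + a) ((c - a) * 1 + a)).
  { replace ((c - a) * 0 + a) with a by ring. replace ((c - a) * 1 + a) with c by ring. exact Hex. }
  set (k := fun s => g ((c - a) * s + a)).
  assert (Hk : forall s, Rmin 0 1 <= s <= Rmax 0 1 -> continuousC k s).
  { intros s Hs. rewrite Rmin_left, Rmax_right in Hs by lra.
    apply (continuousC_comp s (fun s => (c - a) * s + a)).
    - apply (continuous_plus (V := R_NormedModule)); [ | apply continuous_const].
      apply (continuous_scal_r (V := R_NormedModule)), continuous_id.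
    - apply Hg. destruct (Rle_or_lt a c).
      + rewrite Rmin_left, Rmax_right by lra. split; nra.
      + rewrite Rmin_right, Rmax_left by lra. split; nra. }
  transitivity (CRInt (fun s => scal (V := C_R_NormedModule) (c - a) (k s)) 0 1).
  { symmetry. exact (RInt_comp_lin (V := C_R_CompleteNormedModule) g (c - a) a 0 1 Hex'). }
  transitivity (scal (V := C_R_NormedModule) (c - a) (CRInt k 0 1)).
  { exact (RInt_scal (V := C_R_CompleteNormedModule) k 0 1 (c - a) (ex_CRInt_continuous k 0 1 Hk)). }
  replace (CRInt k 0 1) with (CRInt (fun s => g (a + (c - a) * s)) 0 1).
  2:{ apply (RInt_ext (V := C_R_CompleteNormedModule)). intros s _. unfold k. f_equal; ring. }
  destruct (CRInt (fun s => g (a + (c - a) * s)) 0 1) as [u v].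
  change (@eq C ((c - a) * u, (c - a) * v) (Cmult (RtoC (c - a)) (u, v))).
  unfold Cmult, RtoC; simpl. f_equal; ring.
Qed.

Lemma continuous_CRInt_param {T : UniformSpace} (phi : T -> R -> C) (a c : T -> R) (p0 : T) :
  locally p0 (fun p => continuous a p /\ continuous c p /\
     forall s, Rmin (a p) (c p) <= s <= Rmax (a p) (c p) ->
     continuousC2
       (fun z => phi (fst z) (snd z)) (p, s)) ->
  continuousC (fun p => CRInt (phi p) (a p) (c p)) p0.
Proof.
  intros Hl.
  assert (H0 := locally_singleton _ _ Hl).
  apply (continuous_ext_loc _ (fun p => Cmult (RtoC (c p - a p))
    (CRInt (fun s => phi p (segment_point (a p) (c p) s)) 0 1))).
  { revert Hl; apply filter_imp; intros p [_ [_ Hp]]. symmetry. apply CRInt_unit.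
    intros s Hs. apply continuous_slice, Hp, Hs. }
  apply continuousC_mult.
  { apply continuousC_RtoC. destruct H0 as [Ha [Hc _]].
    apply (continuous_minus (V := R_NormedModule)); assumption. }
  apply (continuous_CRInt_unit (fun p s => phi p (segment_point (a p) (c p) s))).
  revert Hl; apply filter_imp; intros p [Ha [Hc Hp]] s Hs.
  apply (continuousC_comp (S := prod_UniformSpace T R_UniformSpace) (p, s)
    (fun z => (fst z, segment_point (a (fst z)) (c (fst z)) (snd z)))
    (fun z => phi (fst z) (snd z))).
  - apply continuous_pair; [apply continuous_fst | ]. unfold segment_point.
    assert (Ha' : continuous (T := prod_UniformSpace T R_UniformSpace) (fun z => a (fst z)) (p, s)).
    { apply (continuous_comp fst a); [apply continuous_fst | exact Ha]. }
    assert (Hc' : continuous (T := prod_UniformSpace T R_UniformSpace) (fun z => c (fst z)) (p, s)).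
    { apply (continuous_comp fst c); [apply continuous_fst | exact Hc]. }
    apply (continuous_plus (V := R_NormedModule)); [exact Ha' | ].
    apply (continuous_mult (K := R_AbsRing)); [ | apply continuous_snd].
    apply (continuous_minus (V := R_NormedModule)); assumption.
  - apply Hp. simpl. unfold segment_point. destruct (Rle_or_lt (a p) (c p)).
    + rewrite Rmin_left, Rmax_right by lra. split; nra.
    + rewrite Rmin_right, Rmax_left by lra. split; nra.
Qed.

(** The Leibniz rule with hypotheses on a neighbourhood of the compact set of
    integration, the form in which they are available on an open domain. *)
Lemma is_derive_RInt_param_bounds (k kx : R -> R -> R) (a c : R -> R) (x da dc : R) :
  is_derive a x da -> is_derive c x dc ->
  (exists e : posreal, forall y s, Rabs (y - x) < e ->
     Rmin (a x) (c x) - e < s < Rmax (a x) (c x) + e ->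
     is_derive (fun y => k y s) y (kx y s) /\ continuous (k y) s /\
     continuous (T := R2)
       (fun z => kx (fst z) (snd z)) (y, s)) ->
  is_derive (fun y => RInt (k y) (a y) (c y)) x
    (RInt (kx x) (a x) (c x) - k x (a x) * da + k x (c x) * dc).
Proof.
  intros Ha Hc [e He].
  assert (He2 : 0 < e / 2 < e) by (destruct e; simpl; lra).
  set (e2 := pos_div_2 e).
  assert (He2' : 0 < e2 < e) by exact He2.
  assert (Hm : forall u v : R, Rmin u v <= u <= Rmax u v /\ Rmin u v <= v <= Rmax u v).
  { intros u v. pose proof (Rmin_l u v). pose proof (Rmin_r u v).
    pose proof (Rmax_l u v). pose proof (Rmax_r u v). lra. }
  assert (Hma := proj1 (Hm (a x) (c x))). assert (Hmc := proj2 (Hm (a x) (c x))).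
  assert (Hx : Rabs (x - x) < e).
  { replace (x - x) with 0 by ring. rewrite Rabs_R0. apply cond_pos. }
  assert (Hex : forall y u v, Rabs (y - x) < e ->
    Rmin (a x) (c x) - e < u < Rmax (a x) (c x) + e ->
    Rmin (a x) (c x) - e < v < Rmax (a x) (c x) + e ->
    ex_RInt (k y) u v).
  { intros y u v Hy Hu Hv. apply (ex_RInt_continuous (V := R_CompleteNormedModule)).
    intros s Hs. apply (He y s Hy).
    assert (Rmin u v > Rmin (a x) (c x) - e) by (apply Rmin_glb_lt; lra).
    assert (Rmax u v < Rmax (a x) (c x) + e) by (apply Rmax_lub_lt; lra). lra. }
  assert (H2d : forall y s, Rabs (y - x) < e ->
     Rmin (a x) (c x) - e < s < Rmax (a x) (c x) + e ->
     continuity_2d_pt (fun u v => Derive (fun z => k z v) u) y s).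
  { intros y s Hy Hs.
    apply (continuity_2d_pt_ext_loc kx).
    - assert (Hd : 0 < Rmin (e - Rabs (y - x))
        (Rmin (s - (Rmin (a x) (c x) - e)) (Rmax (a x) (c x) + e - s))).
      { repeat apply Rmin_glb_lt; lra. }
      exists (mkposreal _ Hd); simpl. intros u v Hu Hv.
      apply Rmin_Rgt in Hu as [Hu _]. apply Rmin_Rgt in Hv as [_ Hv].
      apply Rmin_Rgt in Hv as [Hv1 Hv2].
      symmetry; apply is_derive_unique. apply He.
      + replace (u - x) with ((u - y) + (y - x)) by ring.
        eapply Rle_lt_trans; [apply Rabs_triang | lra].
      + apply Rabs_lt_between in Hv1. apply Rabs_lt_between in Hv2. lra.
    - apply continuity_2d_pt_filterlim, He; assumption. }
  assert (Hnear : locally x (fun y => Rabs (y - x) < e)).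
  { exists e; intros y Hy; exact Hy. }
  assert (H2dl : forall s, Rmin (a x) (c x) <= s <= Rmax (a x) (c x) ->
    locally_2d (fun x' t => continuity_2d_pt (fun u v => Derive (fun z => k z v) u) x' t) x s).
  { intros s Hs. exists e. intros u v Hu Hv. apply H2d; trivial.
    apply Rabs_lt_between in Hv. lra. }
  evar_last.
  - apply (is_derive_RInt_param_bound_comp k a c x da dc); trivial.
    + revert Hnear; apply filter_imp; intros y Hy. apply Hex; trivial; lra.
    + exists e2. revert Hnear; apply filter_imp; intros y Hy. apply Hex; trivial; lra.
    + exists e2. revert Hnear; apply filter_imp; intros y Hy. apply Hex; trivial; lra.
    + exists e2. revert Hnear; apply filter_imp; intros y Hy s Hs. exists (kx y s).
      apply He; trivial.
      assert (Rmin (a x - e2) (c x - e2) > Rmin (a x) (c x) - e) by (apply Rmin_glb_lt; lra).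
      assert (Rmax (a x + e2) (c x + e2) < Rmax (a x) (c x) + e) by (apply Rmax_lub_lt; lra). lra.
    + intros s Hs. apply H2d; trivial. lra.
    + apply H2dl; lra.
    + apply H2dl; lra.
    + apply continuity_pt_filterlim. apply (He x (a x)); trivial; lra.
    + apply continuity_pt_filterlim. apply (He x (c x)); trivial; lra.
  - rewrite (RInt_ext (fun t => Derive (fun u => k u t) x) (kx x)); [ring | ].
    intros s Hs. apply is_derive_unique. apply He; trivial; lra.
Qed.

Lemma is_deriveC_CRInt_param (k kx : R -> R -> C) (a c : R -> R) (x da dc : R) :
  is_derive a x da -> is_derive c x dc ->
  (exists e : posreal, forall y s, Rabs (y - x) < e ->
     Rmin (a x) (c x) - e < s < Rmax (a x) (c x) + e ->
     is_deriveC (fun y => k y s) y (kx y s) /\ continuousC (k y) s /\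
     continuousC2 (fun z => kx (fst z) (snd z)) (y, s)) ->
  is_deriveC (fun y => CRInt (k y) (a y) (c y)) x
    (Cplus (Cminus (CRInt (kx x) (a x) (c x)) (Cmult (k x (a x)) (RtoC da)))
      (Cmult (k x (c x)) (RtoC dc))).
Proof.
  intros Ha Hc [e He].
  assert (Hx : Rabs (x - x) < e).
  { replace (x - x) with 0 by ring. rewrite Rabs_R0. apply cond_pos. }
  assert (Hca : continuous a x) by (apply (ex_derive_continuous (V := R_NormedModule)); exists da; exact Ha).
  assert (Hcc : continuous c x) by (apply (ex_derive_continuous (V := R_NormedModule)); exists dc; exact Hc).
  assert (Hl : locally x (fun y => Rabs (y - x) < e /\ Rabs (a y - a x) < e /\ Rabs (c y - c x) < e)).
  { apply filter_and; [ exists e; intros y Hy; exact Hy | apply filter_and].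
    - apply (proj1 (filterlim_locally a _) Hca e).
    - apply (proj1 (filterlim_locally c _) Hcc e). }
  assert (Hm : forall u v : R, Rmin u v <= u <= Rmax u v /\ Rmin u v <= v <= Rmax u v).
  { intros u v. pose proof (Rmin_l u v). pose proof (Rmin_r u v).
    pose proof (Rmax_l u v). pose proof (Rmax_r u v). lra. }
  assert (Hma := proj1 (Hm (a x) (c x))). assert (Hmc := proj2 (Hm (a x) (c x))).
  apply (is_derive_ext_loc (V := C_R_NormedModule) (fun y =>
    (RInt (fun s => Re (k y s)) (a y) (c y), RInt (fun s => Im (k y s)) (a y) (c y)))).
  { revert Hl; apply filter_imp; intros y [Hy [Hay Hcy]].
    symmetry; apply CRInt_pair, ex_CRInt_continuous. intros s Hs. apply He; trivial.
    apply Rabs_lt_between in Hay. apply Rabs_lt_between in Hcy.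
    assert (Rmin (a y) (c y) > Rmin (a x) (c x) - e) by (apply Rmin_glb_lt; lra).
    assert (Rmax (a y) (c y) < Rmax (a x) (c x) + e) by (apply Rmax_lub_lt; lra). lra. }
  assert (Hint : CRInt (kx x) (a x) (c x) =
    (RInt (fun s => Re (kx x s)) (a x) (c x), RInt (fun s => Im (kx x s)) (a x) (c x))).
  { apply CRInt_pair, ex_CRInt_continuous. intros s Hs. apply continuous_slice.
    apply He; trivial. destruct e; simpl; lra. }
  rewrite Hint.
  apply is_derive_C_iff; split; simpl.
  - evar_last.
    + apply (is_derive_RInt_param_bounds (fun y s => Re (k y s)) (fun y s => Re (kx y s)) a c x da dc); trivial.
      exists e. intros y s Hy Hs. destruct (He y s Hy Hs) as [H1 [H2 H3]].
      apply is_derive_C_iff in H1. apply continuous_C_iff in H2. apply continuous_C_iff in H3. tauto.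
    + unfold Re, Im; ring.
  - evar_last.
    + apply (is_derive_RInt_param_bounds (fun y s => Im (k y s)) (fun y s => Im (kx y s)) a c x da dc); trivial.
      exists e. intros y s Hy Hs. destruct (He y s Hy Hs) as [H1 [H2 H3]].
      apply is_derive_C_iff in H1. apply continuous_C_iff in H2. apply continuous_C_iff in H3. tauto.
    + unfold Re, Im; ring.
Qed.

(** * Regularity of the Goursat solution *)

Lemma is_deriveC_unique (g : R -> C) (x : R) (l1 l2 : C) :
  is_deriveC g x l1 -> is_deriveC g x l2 -> l1 = l2.
Proof.
  rewrite !is_derive_C_iff; intros [H1 H2] [H3 H4].
  apply is_derive_unique in H1, H2, H3, H4.
  destruct l1, l2; simpl in *; congruence.
Qed.

Lemma CRInt_point (g : R -> C) (a : R) : CRInt g a a = RtoC 0.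
Proof. exact (RInt_point (V := C_R_CompleteNormedModule) a g). Qed.

Lemma is_deriveC_CRInt_upper (g : R -> C) (a x : R) :
  (exists e : posreal, forall s, Rmin a x - e < s < Rmax a x + e -> continuousC g s) ->
  is_deriveC (fun y => CRInt g a y) x (g x).
Proof.
  intros [e He].
  pose proof (Rmin_l a x). pose proof (Rmin_r a x).
  pose proof (Rmax_l a x). pose proof (Rmax_r a x).
  pose proof (cond_pos e).
  apply (is_derive_RInt (V := C_R_NormedModule) g (fun y => CRInt g a y) a x).
  - exists e. intros y Hy. apply Rabs_lt_between in Hy. unfold minus, plus, opp in Hy; simpl in Hy.
    apply (RInt_correct (V := C_R_CompleteNormedModule)).
    apply ex_CRInt_continuous. intros s Hs. apply He.
    assert (Rmin a y > Rmin a x - e) by (apply Rmin_glb_lt; lra).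
    assert (Rmax a y < Rmax a x + e) by (apply Rmax_lub_lt; lra). lra.
  - apply He; lra.
Qed.

Lemma continuous_on_interior {T U : UniformSpace} (D : T -> Prop) (g : T -> U) (x : T) :
  continuous_on D g -> locally x D -> continuous g x.
Proof.
  intros Hg Hx P HP.
  generalize (filter_and _ _ Hx (Hg x (locally_singleton _ _ Hx) P HP)).
  unfold within. unfold filtermap at 1. apply filter_imp. intros y [H1 H2]; exact (H2 H1).
Qed.

Lemma continuous_Rplus {T : UniformSpace} (g1 g2 : T -> R) (x : T) :
  continuous g1 x -> continuous g2 x -> continuous (fun y => g1 y + g2 y) x.
Proof. exact (continuous_plus (V := R_NormedModule) g1 g2 x). Qed.

Lemma goursat_interior_iff (b u v : R) :
  goursat_interior b u v <-> -b < u < b /\ -b < v < b /\ -b < u + v < b.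
Proof.
  unfold goursat_interior. rewrite !Rabs_lt_between. tauto.
Qed.

Lemma goursat_interior_left (b u v s : R) :
  goursat_interior b u v -> Rmin 0 u <= s <= Rmax 0 u -> goursat_interior b s v.
Proof.
  rewrite !goursat_interior_iff. intros H.
  unfold Rmin, Rmax. destruct Rle_dec; lra.
Qed.

Lemma goursat_interior_right (b u v s : R) :
  goursat_interior b u v -> Rmin 0 v <= s <= Rmax 0 v -> goursat_interior b u s.
Proof.
  rewrite !goursat_interior_iff. intros H.
  unfold Rmin, Rmax. destruct Rle_dec; lra.
Qed.

Lemma goursat_interior_open (b u v : R) :
  goursat_interior b u v ->
  exists e : posreal, forall u' v', Rabs (u' - u) < e -> Rabs (v' - v) < e ->
    goursat_interior b u' v'.
Proof.
  rewrite goursat_interior_iff. intros H.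
  assert (He : 0 < Rmin (Rmin (b - u) (b + u)) (Rmin (Rmin (b - v) (b + v))
    (Rmin ((b - (u + v)) / 2) ((b + (u + v)) / 2)))).
  { repeat apply Rmin_glb_lt; lra. }
  exists (mkposreal _ He). intros u' v'; simpl. rewrite goursat_interior_iff.
  intros Hu Hv.
  apply Rmin_Rgt in Hu as [Hu1 Hu2]. apply Rmin_Rgt in Hu1 as [Hu3 Hu4].
  apply Rmin_Rgt in Hu2 as [_ Hu2]. apply Rmin_Rgt in Hu2 as [Hu5 Hu6].
  apply Rmin_Rgt in Hv as [_ Hv2]. apply Rmin_Rgt in Hv2 as [Hv1 Hv2].
  apply Rmin_Rgt in Hv1 as [Hv3 Hv4]. apply Rmin_Rgt in Hv2 as [Hv5 Hv6].
  unfold Rabs in *. destruct (Rcase_abs (u' - u)), (Rcase_abs (v' - v)); lra.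
Qed.

(** A uniform neighbourhood of the vertical segment from (u, 0) to (u, v), over which
    the equation is integrated. It lies in the domain because the domain is convex and
    contains both ends. *)
Lemma goursat_interior_thick_right (b u v : R) :
  goursat_interior b u v ->
  exists e : posreal, forall y s, Rabs (y - u) < e ->
    Rmin 0 v - e < s < Rmax 0 v + e -> goursat_interior b y s.
Proof.
  rewrite goursat_interior_iff. intros Huv.
  destruct (goursat_interior_open b u 0) as [e1 He1]; [apply goursat_interior_iff; lra | ].
  destruct (goursat_interior_open b u v) as [e2 He2]; [apply goursat_interior_iff; lra | ].
  assert (He : 0 < Rmin e1 e2 / 2).
  { pose proof (cond_pos e1). pose proof (cond_pos e2).
    assert (0 < Rmin e1 e2) by (apply Rmin_glb_lt; lra). lra. }
  exists (mkposreal _ He). simpl. intros y s Hy Hs.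
  pose proof (Rmin_l e1 e2). pose proof (Rmin_r e1 e2).
  set (e := Rmin e1 e2 / 2) in *.
  assert (Hee : e = Rmin e1 e2 / 2) by reflexivity.
  assert (Hyp : Rabs e = e /\ Rabs (- e) = e).
  { rewrite Rabs_Ropp, Rabs_pos_eq; lra. }
  assert (H1 := He1 y e). assert (H2 := He1 y (- e)).
  assert (H3 := He2 y (v + e)). assert (H4 := He2 y (v - e)).
  replace (e - 0) with e in H1 by ring. replace (- e - 0) with (- e) in H2 by ring.
  replace (v + e - v) with e in H3 by ring. replace (v - e - v) with (- e) in H4 by ring.
  rewrite goursat_interior_iff in *.
  specialize (H1 ltac:(lra) ltac:(lra)). specialize (H2 ltac:(lra) ltac:(lra)).
  specialize (H3 ltac:(lra) ltac:(lra)). specialize (H4 ltac:(lra) ltac:(lra)).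
  clear He1 He2. clearbody e. clear Hyp. apply Rabs_lt_between in Hy.
  revert Hs. unfold Rmin, Rmax in *. destruct (Rle_dec 0 v); lra.
Qed.


Lemma goursat_interior_locally (b u v : R) :
  goursat_interior b u v ->
  locally (T := R2) (u, v) (fun p => goursat_interior b (fst p) (snd p)).
Proof.
  intros H. destruct (goursat_interior_open b u v H) as [e He].
  exists e. intros [u' v'] [Hu Hv]. apply He; [exact Hu | exact Hv].
Qed.

Definition continuous_interior (b : R) (G : R -> R -> C) : Prop :=
  forall u v, goursat_interior b u v -> continuousC2 (fun p => G (fst p) (snd p)) (u, v).

Lemma continuousC2_comp {T : UniformSpace} (G : R -> R -> C) (g1 g2 : T -> R) (x : T) :
  continuousC2 (fun p => G (fst p) (snd p)) (g1 x, g2 x) ->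
  continuous g1 x -> continuous g2 x ->
  continuousC (fun y => G (g1 y) (g2 y)) x.
Proof.
  intros H H1 H2.
  apply (continuousC_comp (S := R2) x (fun y => (g1 y, g2 y)) (fun p => G (fst p) (snd p)));
    [apply continuous_pair | ]; assumption.
Qed.

Lemma continuous_fst_at {U V : UniformSpace} (z : U * V) :
  continuous (T := prod_UniformSpace U V) fst z.
Proof. destruct z; apply continuous_fst. Qed.

Lemma continuous_snd_at {U V : UniformSpace} (z : U * V) :
  continuous (T := prod_UniformSpace U V) snd z.
Proof. destruct z; apply continuous_snd. Qed.

Lemma continuous_fst_fst {U V W : UniformSpace} (z : (U * V) * W) :
  continuous (T := prod_UniformSpace (prod_UniformSpace U V) W) (fun z => fst (fst z)) z.
Proof.
  apply (continuous_comp (V := prod_UniformSpace U V) fst fst); apply continuous_fst_at.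
Qed.

Lemma continuous_snd_fst {U V W : UniformSpace} (z : (U * V) * W) :
  continuous (T := prod_UniformSpace (prod_UniformSpace U V) W) (fun z => snd (fst z)) z.
Proof.
  apply (continuous_comp (V := prod_UniformSpace U V) fst snd);
    [apply continuous_fst_at | apply continuous_snd_at].
Qed.

Lemma continuous_interior_RInt_left (b : R) (G : R -> R -> C) :
  continuous_interior b G ->
  continuous_interior b (fun u v => CRInt (fun s => G s v) 0 u).
Proof.
  intros HG u v Huv.
  apply (continuous_CRInt_param (T := R2) (fun p s => G s (snd p)) (fun _ => 0) fst).
  generalize (goursat_interior_locally b u v Huv). apply filter_imp.
  intros p Hp. split; [apply continuous_const | split; [apply continuous_fst_at | ]].
  intros s Hs.
  apply (continuousC2_comp (T := prod_UniformSpace R2 R_UniformSpace) G snd (fun z => snd (fst z))).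
  - apply HG, (goursat_interior_left b (fst p)); assumption.
  - apply continuous_snd_at.
  - apply continuous_snd_fst.
Qed.

Lemma continuous_interior_RInt_right (b : R) (G : R -> R -> C) :
  continuous_interior b G ->
  continuous_interior b (fun u v => CRInt (fun s => G u s) 0 v).
Proof.
  intros HG u v Huv.
  apply (continuous_CRInt_param (T := R2) (fun p s => G (fst p) s) (fun _ => 0) snd).
  generalize (goursat_interior_locally b u v Huv). apply filter_imp.
  intros p Hp. split; [apply continuous_const | split; [apply continuous_snd_at | ]].
  intros s Hs.
  apply (continuousC2_comp (T := prod_UniformSpace R2 R_UniformSpace) G (fun z => fst (fst z)) snd).
  - apply HG, (goursat_interior_right b _ (snd p)); assumption.
  - apply continuous_fst_fst.
  - apply continuous_snd_at.
Qed.

Lemma continuous_interior_ext (b : R) (G1 G2 : R -> R -> C) :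
  (forall u v, goursat_interior b u v -> G1 u v = G2 u v) ->
  continuous_interior b G1 -> continuous_interior b G2.
Proof.
  intros HE HG u v Huv.
  apply (continuous_ext_loc (T := R2) _ (fun p => G1 (fst p) (snd p))); [ | apply HG, Huv].
  generalize (goursat_interior_locally b u v Huv). apply filter_imp.
  intros p Hp; apply HE, Hp.
Qed.

Lemma continuous_interior_slice_right (b : R) (G : R -> R -> C) (u v : R) :
  continuous_interior b G -> goursat_interior b u v -> continuousC (fun s => G u s) v.
Proof. intros HG Huv. apply (continuous_slice (T := R_UniformSpace) G u v), HG, Huv. Qed.

Lemma continuous_interior_slice_left (b : R) (G : R -> R -> C) (u v : R) :
  continuous_interior b G -> goursat_interior b u v -> continuousC (fun s => G s v) u.
Proof.
  intros HG Huv. apply (continuousC2_comp G (fun s => s) (fun _ => v)).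
  - apply HG, Huv.
  - apply continuous_id.
  - apply continuous_const.
Qed.

(** The Goursat problem with both first derivatives of H and with the two orders of
    the mixed derivative. The data on the axis v = 0 are kept in differentiated form, as
    Hu(u, 0): that is how they enter the first-order system for a pair of kernels. *)
Record regular_goursat (b : R) (q : R -> C) (h : C) (H Hu Hv : R -> R -> C) : Prop := {
  rg_cont : continuous_interior b H;
  rg_cont_u : continuous_interior b Hu;
  rg_cont_v : continuous_interior b Hv;
  rg_u : forall u v, goursat_interior b u v -> is_deriveC (fun y => H y v) u (Hu u v);
  rg_v : forall u v, goursat_interior b u v -> is_deriveC (fun y => H u y) v (Hv u v);
  rg_uv : forall u v, goursat_interior b u v ->
    is_deriveC (fun y => Hu u y) v (Cmult (q (u + v)) (H u v));
  rg_vu : forall u v, goursat_interior b u v ->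
    is_deriveC (fun y => Hv y v) u (Cmult (q (u + v)) (H u v));
  rg_u0 : forall u, -b < u < b -> Hu u 0 = Cdiv (q u) (RtoC 2);
  rg_v0 : forall v, -b < v < b -> Hv 0 v = RtoC 0;
  rg_0v : forall v, -b < v < b -> H 0 v = Cdiv h (RtoC 2)
}.

(** Only Hv is given. Since H is constant on the axis u = 0, Hv vanishes there, so
    integrating the equation in u makes Hv an integral of a continuous function, hence
    jointly continuous. Integrating Hv in v from the other axis and differentiating under
    the integral then produces Hu. *)
Lemma goursat_solution_regular (b : R) (hb : 0 < b) (q : R -> C) (h : C) (H : R -> R -> C) :
  (forall x, -b < x < b -> continuousC q x) ->
  is_goursat_solution b q h H ->
  exists Hu Hv, regular_goursat b q h H Hu Hv.
Proof.
  intros Hq [Hc [[Hv HHv] [HH0 H0H]]].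
  set (G := fun u v => Cmult (q (u + v)) (H u v)).
  assert (CH : continuous_interior b H).
  { intros u v Huv. apply (continuous_on_interior _ _ _ Hc).
    generalize (goursat_interior_locally b u v Huv). apply filter_imp.
    intros p [H1 [H2 H3]]; repeat split; lra. }
  assert (CG : continuous_interior b G).
  { intros u v Huv. apply continuousC_mult; [ | apply CH, Huv].
    apply goursat_interior_iff in Huv.
    apply (continuousC_comp (T := R2) (S := R_UniformSpace) (u, v) (fun p => fst p + snd p)); [ | apply Hq; simpl; lra].
    apply continuous_Rplus; [apply continuous_fst_at | apply continuous_snd_at]. }
  assert (Hv0 : forall v, -b < v < b -> Hv 0 v = RtoC 0).
  { intros v Hv'.
    assert (Hi : goursat_interior b 0 v) by (apply goursat_interior_iff; lra).
    apply (is_deriveC_unique (fun y => H 0 y) v); [apply HHv, Hi | ].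
    apply (is_derive_ext_loc (V := C_R_NormedModule) (fun _ => Cdiv h (RtoC 2)));
      [ | apply is_deriveC_const].
    destruct (goursat_interior_open b 0 v Hi) as [e He]. exists e. intros y Hy.
    symmetry; apply H0H.
    assert (Hi' : goursat_interior b 0 y).
    { apply He; [ | exact Hy]. rewrite Rminus_diag, Rabs_R0. apply cond_pos. }
    apply goursat_interior_iff in Hi'. unfold segment; lra. }
  assert (EHv : forall u v, goursat_interior b u v -> CRInt (fun s => G s v) 0 u = Hv u v).
  { intros u v Huv.
    rewrite (CRInt_derive (fun s => Hv s v)).
    - rewrite Hv0; [C_eq; ring | ]. apply goursat_interior_iff in Huv; lra.
    - intros s Hs. apply HHv, (goursat_interior_left b u); assumption.
    - intros s Hs. apply (continuous_interior_slice_left b G s v CG), (goursat_interior_left b u); assumption. }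
  assert (CHv : continuous_interior b Hv).
  { apply (continuous_interior_ext b _ _ EHv), continuous_interior_RInt_left, CG. }
  set (Hu := fun u v => Cplus (Cdiv (q u) (RtoC 2)) (CRInt (fun s => G u s) 0 v)).
  assert (CHu : continuous_interior b Hu).
  { intros u v Huv. apply continuousC_plus; [ | exact (continuous_interior_RInt_right b G CG u v Huv)].
    apply continuousC_mult; [ | apply continuousC_const].
    apply (continuousC_comp (T := R2) (S := R_UniformSpace) (u, v) fst); [apply continuous_fst_at | apply Hq].
    apply goursat_interior_iff in Huv; simpl; lra. }
  exists Hu, Hv. constructor; trivial.
  - intros u v Huv.
    assert (Hu' := proj1 (goursat_interior_iff b u v) Huv).
    destruct (goursat_interior_open b u v Huv) as [e He].
    apply (is_derive_ext_loc (V := C_R_NormedModule)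
      (fun y => Cplus (Cplus (Cdiv h (RtoC 2)) (Cdiv (CRInt q 0 y) (RtoC 2))) (CRInt (fun s => Hv y s) 0 v))).
    { exists e. intros y Hy.
      assert (Hi : goursat_interior b y v).
      { apply He; [exact Hy | ]. rewrite Rminus_diag, Rabs_R0. apply cond_pos. }
      rewrite (CRInt_derive (fun s => H y s) (fun s => Hv y s)).
      - rewrite HH0; [C_eq; ring | ]. apply goursat_interior_iff in Hi; unfold segment; lra.
      - intros s Hs. apply HHv, (goursat_interior_right b _ v); assumption.
      - intros s Hs. apply (continuous_interior_slice_right b Hv y s CHv), (goursat_interior_right b _ v); assumption. }
    apply is_deriveC_plus.
    + assert (Hq' : is_deriveC (fun y => CRInt q 0 y) u (q u)).
      { apply is_deriveC_CRInt_upper.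
        assert (He1 : 0 < Rmin (b - u) (b + u)) by (apply Rmin_glb_lt; lra).
        exists (mkposreal _ He1); simpl. intros s Hs. apply Hq.
        pose proof (Rmin_l (b - u) (b + u)). pose proof (Rmin_r (b - u) (b + u)).
        revert Hs. unfold Rmin at 1, Rmax. destruct Rle_dec; lra. }
      evar_last.
      * apply is_deriveC_plus; [apply is_deriveC_const | ].
        apply is_deriveC_mult; [apply Hq' | apply is_deriveC_const].
      * C_eq; unfold Cdiv; ring.
    + evar_last.
      * apply (is_deriveC_CRInt_param Hv G (fun _ => 0) (fun _ => v) u 0 0);
          [apply (is_derive_const (V := R_NormedModule)) | apply (is_derive_const (V := R_NormedModule)) | ].
        destruct (goursat_interior_thick_right b u v Huv) as [e' He'].
        exists e'. intros y s Hy Hs. assert (Hi := He' y s Hy Hs).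
        split; [ | split].
        -- apply HHv, Hi.
        -- apply (continuous_interior_slice_right b Hv y s CHv Hi).
        -- apply CG, Hi.
      * C_eq; change (CRInt (fun s => G u s) 0 v) with (CRInt (G u) 0 v); ring.
  - intros u v Huv. apply HHv, Huv.
  - intros u v Huv. evar_last.
    + apply is_deriveC_plus; [apply is_deriveC_const | ].
      apply is_deriveC_CRInt_upper.
      destruct (goursat_interior_thick_right b u v Huv) as [e He]. exists e. intros s Hs.
      apply (continuous_interior_slice_right b G u s CG). apply He; trivial.
      rewrite Rminus_diag, Rabs_R0. apply cond_pos.
    + C_eq; unfold G; ring.
  - intros u v Huv. apply HHv, Huv.
  - intros u Hu'. unfold Hu. rewrite CRInt_point. C_eq; ring.
  - intros v Hv'. apply H0H. unfold segment; lra.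
Qed.

(** * Uniqueness for a homogeneous first-order Goursat system *)

(** The radius of continuity at (s, t) is chosen at most 1 / (1 + |phi s t|), so that a
    uniform lower bound d for the radii also bounds phi by 1 + 1/d. *)
Lemma unit_square_bounded_R (phi : R -> R -> R) :
  (forall s t, 0 <= s <= 1 -> 0 <= t <= 1 ->
     continuous (T := R2) (fun p => phi (fst p) (snd p)) (s, t)) ->
  exists N, forall s t, 0 <= s <= 1 -> 0 <= t <= 1 -> Rabs (phi s t) <= N.
Proof.
  intros Hc.
  assert (Hd : forall s t, exists d : posreal, 0 <= s <= 1 -> 0 <= t <= 1 ->
    d * (1 + Rabs (phi s t)) <= 1 /\
    forall s' t', Rabs (s' - s) < d -> Rabs (t' - t) < d -> Rabs (phi s' t' - phi s t) < 1).
  { intros s t.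
    destruct (excluded_middle_informative (0 <= s <= 1 /\ 0 <= t <= 1)) as [[Hs Ht] | Hst].
    - destruct (proj1 (filterlim_locally (fun p => phi (fst p) (snd p)) _)
        (Hc s t Hs Ht) (mkposreal 1 Rlt_0_1)) as [d Hd].
      pose proof (Rabs_pos (phi s t)) as Hp.
      assert (Hpos : 0 < Rmin d (/ (1 + Rabs (phi s t)))).
      { apply Rmin_glb_lt; [apply cond_pos | apply Rinv_0_lt_compat; lra]. }
      exists (mkposreal _ Hpos); simpl. intros _ _. split.
      + apply Rle_trans with (/ (1 + Rabs (phi s t)) * (1 + Rabs (phi s t))).
        * apply Rmult_le_compat_r; [lra | apply Rmin_r].
        * right; field; lra.
      + intros s' t' Hs' Ht'. apply (Hd (s', t')). split; simpl.
        * eapply Rlt_le_trans; [exact Hs' | apply Rmin_l].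
        * eapply Rlt_le_trans; [exact Ht' | apply Rmin_l].
    - exists (mkposreal 1 Rlt_0_1); tauto. }
  set (delta := fun s t => proj1_sig (constructive_indefinite_description _ (Hd s t))).
  assert (Hdelta : forall s t, 0 <= s <= 1 -> 0 <= t <= 1 ->
    delta s t * (1 + Rabs (phi s t)) <= 1 /\
    forall s' t', Rabs (s' - s) < delta s t -> Rabs (t' - t) < delta s t ->
      Rabs (phi s' t' - phi s t) < 1).
  { intros s t; unfold delta.
    destruct (constructive_indefinite_description _ (Hd s t)); simpl; assumption. }
  destruct (compactness_value_2d 0 1 0 1 delta) as [d H0].
  exists (1 + / d). intros s t Hs Ht.
  destruct (NNPP _ (H0 s t Hs Ht)) as [u [v [Hu [Hv [Hsu [Htv Hdd]]]]]].
  destruct (Hdelta u v Hu Hv) as [H1 H2].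
  specialize (H2 s t Hsu Htv).
  pose proof (Rabs_pos (phi u v)). pose proof (cond_pos d).
  assert (Rabs (phi u v) <= / d).
  { apply Rmult_le_reg_l with d; trivial. rewrite Rinv_r by lra. nra. }
  replace (phi s t) with ((phi s t - phi u v) + phi u v) by ring.
  eapply Rle_trans; [apply Rabs_triang | lra].
Qed.

Lemma Cmod_le_Rabs (z : C) : Cmod z <= Rabs (Re z) + Rabs (Im z).
Proof.
  destruct z as [x y]. unfold Cmod; simpl.
  pose proof (Rabs_pos x). pose proof (Rabs_pos y).
  rewrite <- (sqrt_Rsqr (Rabs x + Rabs y)) by lra.
  apply sqrt_le_1_alt. unfold Rsqr.
  assert (Rabs x * Rabs x = x * x) by (rewrite <- Rabs_mult; apply Rabs_pos_eq; nra).
  assert (Rabs y * Rabs y = y * y) by (rewrite <- Rabs_mult; apply Rabs_pos_eq; nra).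
  nra.
Qed.

Definition continuous_unit_square (phi : R -> R -> C) : Prop :=
  forall s t, 0 <= s <= 1 -> 0 <= t <= 1 ->
    continuousC2 (fun p => phi (fst p) (snd p)) (s, t).

Lemma unit_square_bounded (phi : R -> R -> C) :
  continuous_unit_square phi ->
  exists N, forall s t, 0 <= s <= 1 -> 0 <= t <= 1 -> Cmod (phi s t) <= N.
Proof.
  intros Hc.
  destruct (unit_square_bounded_R (fun s t => Re (phi s t))) as [N1 H1].
  { intros s t Hs Ht. exact (proj1 (proj1 (continuous_C_iff _ _) (Hc s t Hs Ht))). }
  destruct (unit_square_bounded_R (fun s t => Im (phi s t))) as [N2 H2].
  { intros s t Hs Ht. exact (proj2 (proj1 (continuous_C_iff _ _) (Hc s t Hs Ht))). }
  exists (N1 + N2). intros s t Hs Ht.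
  eapply Rle_trans; [apply Cmod_le_Rabs | ].
  specialize (H1 s t Hs Ht). specialize (H2 s t Hs Ht). lra.
Qed.

(** Integrating a bound that grows like exp(k r) gains a factor 1/k. *)
Lemma Cmod_le_exp_of_derive (g dg : R -> C) (D k c s : R) :
  0 < k -> 0 <= s <= 1 -> g 0 = RtoC 0 ->
  (forall r, 0 <= r <= 1 -> is_deriveC g r (dg r)) ->
  (forall r, 0 <= r <= 1 -> continuousC dg r) ->
  (forall r, 0 <= r <= 1 -> Cmod (dg r) <= D * k * exp (k * (c + r))) ->
  0 <= D ->
  Cmod (g s) <= D * exp (k * (c + s)).
Proof.
  intros Hk Hs H0 Hd Hc Hb HD.
  assert (Hexp : forall r, is_derive (fun r => D * exp (k * (c + r))) r (D * k * exp (k * (c + r)))).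
  { intros r. auto_derive; trivial. ring. }
  assert (H1 : is_RInt (V := C_R_NormedModule) dg 0 s (g s)).
  { assert (HI := is_RInt_derive (V := C_R_CompleteNormedModule) g dg 0 s).
    rewrite Rmin_left, Rmax_right in HI by lra.
    replace (g s) with (minus (G := C_R_NormedModule) (g s) (g 0)).
    - apply HI; intros r Hr; [apply Hd | apply Hc]; lra.
    - rewrite H0. change (@eq C (Cminus (g s) (RtoC 0)) (g s)). ring. }
  assert (H2 : is_RInt (V := R_NormedModule) (fun r => D * k * exp (k * (c + r))) 0 s
    (D * exp (k * (c + s)) - D * exp (k * (c + 0)))).
  { apply (is_RInt_derive (V := R_CompleteNormedModule) (fun r => D * exp (k * (c + r)))).
    - intros r _; apply Hexp.
    - intros r _. apply (ex_derive_continuous (V := R_NormedModule)). auto_derive; trivial. }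
  rewrite Cmod_norm.
  eapply Rle_trans.
  - apply (norm_RInt_le (V := C_R_NormedModule) dg _ 0 s _ _ (proj1 Hs)) with (3 := H2); [ | exact H1].
    intros r Hr. rewrite <- Cmod_norm. apply Hb; lra.
  - pose proof (exp_pos (k * (c + 0))). nra.
Qed.

(** In the norm weighted by exp(-k (s + t)) each of the two integrations gains a factor
    A/k, with A a bound for the coefficients. For k large this is at most 1/2, so any
    bound for (p, q) can be halved again and again. *)
Lemma volterra_unit_square_zero (p q c1 c2 : R -> R -> C) :
  continuous_unit_square p -> continuous_unit_square q ->
  continuous_unit_square c1 -> continuous_unit_square c2 ->
  (forall s t, 0 <= s <= 1 -> 0 <= t <= 1 ->
     is_deriveC (fun y => p s y) t (Cmult (c1 s t) (q s t))) ->
  (forall s t, 0 <= s <= 1 -> 0 <= t <= 1 ->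
     is_deriveC (fun y => q y t) s (Cmult (c2 s t) (p s t))) ->
  (forall s, 0 <= s <= 1 -> p s 0 = RtoC 0) ->
  (forall t, 0 <= t <= 1 -> q 0 t = RtoC 0) ->
  forall s t, 0 <= s <= 1 -> 0 <= t <= 1 -> p s t = RtoC 0 /\ q s t = RtoC 0.
Proof.
  intros Cp Cq Cc1 Cc2 Hp Hq Hp0 Hq0.
  destruct (unit_square_bounded p Cp) as [Np HNp].
  destruct (unit_square_bounded q Cq) as [Nq HNq].
  destruct (unit_square_bounded c1 Cc1) as [A1 HA1].
  destruct (unit_square_bounded c2 Cc2) as [A2 HA2].
  assert (Hz : 0 <= 0 <= 1) by lra.
  assert (P1 := Rle_trans _ _ _ (Cmod_ge_0 _) (HNp 0 0 Hz Hz)).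
  assert (P2 := Rle_trans _ _ _ (Cmod_ge_0 _) (HNq 0 0 Hz Hz)).
  assert (P3 := Rle_trans _ _ _ (Cmod_ge_0 _) (HA1 0 0 Hz Hz)).
  assert (P4 := Rle_trans _ _ _ (Cmod_ge_0 _) (HA2 0 0 Hz Hz)).
  (* The weight k makes both A1 / k and A2 / k at most 1/2. *)
  set (N := Np + Nq). set (k := 2 * (A1 + A2 + 1)).
  assert (Hk : 0 < k) by (unfold k; lra).
  assert (HN : 0 <= N) by (unfold N; lra).
  assert (Hcont : forall f g : R -> R -> C, continuous_unit_square f -> continuous_unit_square g ->
    continuous_unit_square (fun s t => Cmult (f s t) (g s t))).
  { intros f g Hf Hg s t Hs Ht. apply continuousC_mult; [apply Hf | apply Hg]; assumption. }
  assert (Hn : forall n s t, 0 <= s <= 1 -> 0 <= t <= 1 ->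
    Cmod (p s t) <= N * (/ 2) ^ n * exp (k * (s + t)) /\
    Cmod (q s t) <= N * (/ 2) ^ n * exp (k * (t + s))).
  { induction n as [ | n IH]; intros s t Hs Ht.
    - assert (1 <= exp (k * (s + t))).
      { rewrite <- exp_0. destruct (Req_dec (s + t) 0) as [-> | Hst].
        - rewrite Rmult_0_r; lra.
        - left; apply exp_increasing. nra. }
      rewrite (Rplus_comm t s).
      specialize (HNp s t Hs Ht). specialize (HNq s t Hs Ht). simpl. unfold N in *. nra.
    - assert (HD : 0 <= N * (/ 2) ^ n) by (apply Rmult_le_pos; [lra | apply pow_le; lra]).
      assert (HS : forall A a b e, 0 <= a <= A -> A <= k / 2 -> 0 <= b <= N * (/ 2) ^ n * e -> 0 <= e ->
        a * b <= N * (/ 2) ^ S n * k * e).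
      { intros A a b e Ha HA Hb He. apply Rle_trans with (k / 2 * (N * (/ 2) ^ n * e)).
        - apply Rmult_le_compat; lra.
        - simpl; right; field. }
      assert (HD' : 0 <= N * (/ 2) ^ S n) by (apply Rmult_le_pos; [lra | apply pow_le; lra]).
      split.
      + apply (Cmod_le_exp_of_derive (fun y => p s y) (fun y => Cmult (c1 s y) (q s y))); trivial.
        * apply Hp0, Hs.
        * intros r Hr; apply Hp; assumption.
        * intros r Hr. apply (continuous_slice (T := R_UniformSpace) (fun s y => Cmult (c1 s y) (q s y))).
          apply Hcont; assumption.
        * intros r Hr. rewrite Cmod_mult. apply (HS A1).
          -- split; [apply Cmod_ge_0 | apply HA1; assumption].
          -- unfold k; lra.
          -- split; [apply Cmod_ge_0 | ]. rewrite (Rplus_comm s r). apply IH; assumption.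
          -- left; apply exp_pos.
      + apply (Cmod_le_exp_of_derive (fun y => q y t) (fun y => Cmult (c2 y t) (p y t))); trivial.
        * apply Hq0, Ht.
        * intros r Hr; apply Hq; assumption.
        * intros r Hr. apply (continuousC2_comp (fun s y => Cmult (c2 s y) (p s y)) (fun s => s) (fun _ => t)).
          -- apply Hcont; assumption.
          -- apply continuous_id.
          -- apply continuous_const.
        * intros r Hr. rewrite Cmod_mult. apply (HS A2).
          -- split; [apply Cmod_ge_0 | apply HA2; assumption].
          -- unfold k; lra.
          -- split; [apply Cmod_ge_0 | ]. rewrite (Rplus_comm t r). apply IH; assumption.
          -- left; apply exp_pos. }
  assert (Hlim : forall m e : R, 0 <= e -> 0 <= m -> (forall n, m <= N * (/ 2) ^ n * e) -> m = 0).
  { intros m e He Hm Hb. apply Rle_antisym; trivial.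
    apply (is_lim_seq_le (fun _ => m) (fun n => N * (/ 2) ^ n * e) m 0 Hb).
    - apply is_lim_seq_const.
    - replace (Finite 0) with (Rbar_mult (Rbar_mult N 0) e) by (simpl; f_equal; ring).
      apply is_lim_seq_scal_r, is_lim_seq_scal_l, is_lim_seq_geom.
      rewrite Rabs_pos_eq; lra. }
  intros s t Hs Ht. split; apply Cmod_eq_0.
  - apply (Hlim _ (exp (k * (s + t)))); [left; apply exp_pos | apply Cmod_ge_0 | ].
    intros n; apply (Hn n s t Hs Ht).
  - apply (Hlim _ (exp (k * (t + s)))); [left; apply exp_pos | apply Cmod_ge_0 | ].
    intros n; apply (Hn n s t Hs Ht).
Qed.

Lemma goursat_interior_scale (b u v s t : R) :
  goursat_interior b u v -> 0 <= s <= 1 -> 0 <= t <= 1 -> goursat_interior b (s * u) (t * v).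
Proof.
  intros H Hs Ht.
  apply (goursat_interior_left b u); [apply (goursat_interior_right b u v); trivial | ].
  - unfold Rmin, Rmax; destruct Rle_dec; nra.
  - unfold Rmin, Rmax; destruct Rle_dec; nra.
Qed.

(** The rectangle spanned by (0, 0) and (u, v) stays in the hexagonal domain, and
    rescaling it to the unit square absorbs the signs of u and v into the coefficients. *)
Lemma goursat_system_zero (b : R) (P Q c : R -> R -> C) :
  continuous_interior b P -> continuous_interior b Q -> continuous_interior b c ->
  (forall u v, goursat_interior b u v ->
     is_deriveC (fun y => P u y) v (Cmult (c u v) (Q u v))) ->
  (forall u v, goursat_interior b u v ->
     is_deriveC (fun y => Q y v) u (Cmult (c u v) (P u v))) ->
  (forall u, -b < u < b -> P u 0 = RtoC 0) ->
  (forall v, -b < v < b -> Q 0 v = RtoC 0) ->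
  forall u v, goursat_interior b u v -> P u v = RtoC 0 /\ Q u v = RtoC 0.
Proof.
  intros CP CQ Cc HP HQ HP0 HQ0 u v Huv.
  assert (Hscale : forall G, continuous_interior b G ->
    continuous_unit_square (fun s t => G (s * u) (t * v))).
  { intros G HG s t Hs Ht.
    apply (continuousC2_comp (T := R2) G (fun p => fst p * u) (fun p => snd p * v)).
    - apply HG, goursat_interior_scale; assumption.
    - apply (continuous_mult (K := R_AbsRing)); [apply continuous_fst_at | apply continuous_const].
    - apply (continuous_mult (K := R_AbsRing)); [apply continuous_snd_at | apply continuous_const]. }
  assert (Hlin : forall c s : R, is_derive (fun y => y * c) s c).
  { intros c0 s. auto_derive; trivial. ring. }
  assert (Hscale' : forall G (r : R), continuous_interior b G ->
    continuous_unit_square (fun s t => Cmult (RtoC r) (G (s * u) (t * v)))).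
  { intros G r HG s t Hs Ht. apply continuousC_mult; [apply continuousC_const | apply Hscale; assumption]. }
  assert (H := volterra_unit_square_zero (fun s t => P (s * u) (t * v)) (fun s t => Q (s * u) (t * v))
    (fun s t => Cmult (RtoC v) (c (s * u) (t * v))) (fun s t => Cmult (RtoC u) (c (s * u) (t * v)))
    (Hscale P CP) (Hscale Q CQ) (Hscale' c v Cc) (Hscale' c u Cc)).
  replace u with (1 * u) by ring. replace v with (1 * v) by ring.
  assert (Hi := goursat_interior_scale b u v).
  apply H; try lra.
  - intros s t Hs Ht. rewrite <- Cmult_assoc.
    apply (is_deriveC_comp (fun y => P (s * u) y) (fun y => y * v)); [apply HP; auto | apply Hlin].
  - intros s t Hs Ht. rewrite <- Cmult_assoc.
    apply (is_deriveC_comp (fun y => Q y (t * v)) (fun y => y * u)); [apply HQ; auto | apply Hlin].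
  - intros s Hs. rewrite Rmult_0_l. apply HP0.
    specialize (Hi s 0 Huv Hs ltac:(lra)). apply goursat_interior_iff in Hi; tauto.
  - intros t Ht. rewrite Rmult_0_l. apply HQ0.
    specialize (Hi 0 t Huv ltac:(lra) Ht). apply goursat_interior_iff in Hi; tauto.
Qed.

(** * The kernels of a Darboux pair *)

(** Differentiability in two variables comes from the existence of both partial
    derivatives and the continuity of one of them. *)
Lemma is_deriveC_comp2 (G Gu : R -> R -> C) (r1 r2 : R -> R) (x d1 d2 : R) (Gv : C) :
  locally (T := R2) (r1 x, r2 x)
    (fun p => is_deriveC (fun y => G y (snd p)) (fst p) (Gu (fst p) (snd p))) ->
  is_deriveC (fun y => G (r1 x) y) (r2 x) Gv ->
  continuousC2 (fun p => Gu (fst p) (snd p)) (r1 x, r2 x) ->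
  is_derive r1 x d1 -> is_derive r2 x d2 ->
  is_deriveC (fun y => G (r1 y) (r2 y)) x
    (Cplus (Cmult (RtoC d1) (Gu (r1 x) (r2 x))) (Cmult (RtoC d2) Gv)).
Proof.
  intros HGu HGv Hc H1 H2.
  assert (Hreal : forall (g gu : R -> R -> R) (gv : R),
    locally (T := R2) (r1 x, r2 x)
      (fun p => is_derive (fun y => g y (snd p)) (fst p) (gu (fst p) (snd p))) ->
    is_derive (fun y => g (r1 x) y) (r2 x) gv ->
    continuous (T := R2) (fun p => gu (fst p) (snd p)) (r1 x, r2 x) ->
    is_derive (fun y => g (r1 y) (r2 y)) x (gu (r1 x) (r2 x) * d1 + gv * d2)).
  { intros g gu gv A1 A2 A3. apply is_derive_Reals.
    apply derivable_pt_lim_comp_2d; try (apply is_derive_Reals; assumption).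
    apply filterdiff_differentiable_pt_lim.
    exact (is_derive_filterdiff g (r1 x) (r2 x) gu gv A1 A2 A3). }
  apply is_derive_C_iff in HGv. apply continuous_C_iff in Hc.
  apply is_derive_C_iff; split.
  - evar_last.
    + apply (Hreal (fun u v => Re (G u v)) (fun u v => Re (Gu u v)) (Re Gv)); try tauto.
      revert HGu; apply filter_imp; intros p Hp. apply is_derive_C_iff in Hp; tauto.
    + simpl. unfold Re; ring.
  - evar_last.
    + apply (Hreal (fun u v => Im (G u v)) (fun u v => Im (Gu u v)) (Im Gv)); try tauto.
      revert HGu; apply filter_imp; intros p Hp. apply is_derive_C_iff in Hp; tauto.
    + simpl. unfold Im; ring.
Qed.

Lemma regular_goursat_comp (b : R) (q : R -> C) (h : C) (H Hu Hv : R -> R -> C)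
  (r1 r2 : R -> R) (x d1 d2 : R) :
  regular_goursat b q h H Hu Hv ->
  goursat_interior b (r1 x) (r2 x) -> is_derive r1 x d1 -> is_derive r2 x d2 ->
  is_deriveC (fun y => H (r1 y) (r2 y)) x
    (Cplus (Cmult (RtoC d1) (Hu (r1 x) (r2 x))) (Cmult (RtoC d2) (Hv (r1 x) (r2 x)))).
Proof.
  intros RH Hi H1 H2.
  apply is_deriveC_comp2; trivial.
  - generalize (goursat_interior_locally b _ _ Hi). apply filter_imp.
    intros p Hp. apply (rg_u _ _ _ _ _ _ RH), Hp.
  - apply (rg_v _ _ _ _ _ _ RH), Hi.
  - apply (rg_cont_u _ _ _ _ _ _ RH), Hi.
Qed.

(** The potentials linked by the Darboux transformation: d^2 - q = (d + a)(d - a) and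
    d^2 - p = (d - a)(d + a). For a = f'/f they are the potentials of f and 1/f. *)
Record darboux_pair (b : R) (a a1 q p : R -> C) : Prop := {
  dp_derive : forall x, -b < x < b -> is_deriveC a x (a1 x);
  dp_cont : forall x, -b < x < b -> continuousC a1 x;
  dp_q : forall x, -b < x < b -> q x = Cplus (a1 x) (Cmult (a x) (a x));
  dp_p : forall x, -b < x < b -> p x = Cminus (Cmult (a x) (a x)) (a1 x)
}.

Lemma darboux_pair_swap (b : R) (a a1 q p : R -> C) :
  darboux_pair b a a1 q p ->
  darboux_pair b (fun x => Copp (a x)) (fun x => Copp (a1 x)) p q.
Proof.
  intros [H1 H2 H3 H4]; constructor; intros x Hx.
  - exact (is_derive_opp (V := C_R_NormedModule) a x (a1 x) (H1 x Hx)).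
  - apply continuousC_opp, H2, Hx.
  - rewrite H4 by trivial. ring.
  - rewrite H3 by trivial. ring.
Qed.

Lemma continuous_interior_of_sum (b : R) (g : R -> C) :
  (forall x, -b < x < b -> continuousC g x) -> continuous_interior b (fun u v => g (u + v)).
Proof.
  intros Hg u v Huv. apply goursat_interior_iff in Huv.
  apply (continuousC_comp (T := R2) (S := R_UniformSpace) (u, v) (fun p => fst p + snd p));
    [ | apply Hg; simpl; lra].
  apply continuous_Rplus; [apply continuous_fst_at | apply continuous_snd_at].
Qed.

Section DarbouxKernels.
Variables (b : R) (a a1 q p : R -> C) (H Hu Hv M Mu Mv : R -> R -> C).
Hypothesis hb : 0 < b.
Hypothesis DP : darboux_pair b a a1 q p.
Hypothesis RH : regular_goursat b q (a 0) H Hu Hv.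
Hypothesis RM : regular_goursat b p (Copp (a 0)) M Mu Mv.

(** Both sides have derivative a1 = (q - p)/2 and the value a(0) at 0. *)
Lemma darboux_kernel_axis (x : R) : -b < x < b -> Cminus (H x 0) (M x 0) = a x.
Proof.
  intros Hx.
  assert (Hseg : forall s, Rmin 0 x <= s <= Rmax 0 x -> -b < s < b).
  { intros s. unfold Rmin, Rmax; destruct Rle_dec; lra. }
  assert (Hi : forall s, -b < s < b -> goursat_interior b s 0).
  { intros s Hs; apply goursat_interior_iff; lra. }
  assert (E1 : CRInt a1 0 x = Cminus (a x) (a 0)).
  { apply CRInt_derive; intros s Hs; apply Hseg in Hs;
      [apply (dp_derive _ _ _ _ _ DP) | apply (dp_cont _ _ _ _ _ DP)]; assumption. }
  assert (E2 : CRInt a1 0 x = Cminus (Cminus (H x 0) (M x 0)) (Cminus (H 0 0) (M 0 0))).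
  { apply (CRInt_derive (fun s => Cminus (H s 0) (M s 0))); intros s Hs; apply Hseg in Hs;
      [ | apply (dp_cont _ _ _ _ _ DP); assumption].
    evar_last.
    - apply is_deriveC_minus; [apply (rg_u _ _ _ _ _ _ RH) | apply (rg_u _ _ _ _ _ _ RM)]; apply Hi, Hs.
    - C_eq. rewrite (rg_u0 _ _ _ _ _ _ RH), (rg_u0 _ _ _ _ _ _ RM) by assumption.
      rewrite (dp_q _ _ _ _ _ DP), (dp_p _ _ _ _ _ DP) by assumption.
      field. }
  rewrite E1, (rg_0v _ _ _ _ _ _ RH), (rg_0v _ _ _ _ _ _ RM) in E2 by lra.
  replace (Cminus (H x 0) (M x 0)) with
    (Cplus (Cminus (a x) (a 0)) (Cminus (Cdiv (a 0) (RtoC 2)) (Cdiv (Copp (a 0)) (RtoC 2)))).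
  - field.
  - rewrite E2. ring.
Qed.

(** The defects P and Q of the two equations satisfy P_v = - a Q and Q_u = - a P because
    q and p are a^2 plus and minus a1. The boundary data of the two Goursat problems are
    exactly such that P vanishes for v = 0 and Q for u = 0. *)
Lemma darboux_kernel_system (u v : R) :
  goursat_interior b u v ->
  Cplus (Hu u v) (Mu u v) = Cmult (a (u + v)) (Cminus (H u v) (M u v)) /\
  Cminus (Hv u v) (Mv u v) = Cmult (a (u + v)) (Cplus (H u v) (M u v)).
Proof.
  assert (Ca : forall x, -b < x < b -> continuousC a x).
  { intros x Hx. apply (is_deriveC_continuous a x (a1 x)), (dp_derive _ _ _ _ _ DP), Hx. }
  assert (CA := continuous_interior_of_sum b a Ca).
  assert (Hsum : forall u v, goursat_interior b u v -> -b < u + v < b).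
  { intros u0 v0 Hi; apply goursat_interior_iff in Hi; lra. }
  assert (Da : forall u v, goursat_interior b u v ->
    is_deriveC (fun y => a (u + y)) v (a1 (u + v)) /\ is_deriveC (fun y => a (y + v)) u (a1 (u + v))).
  { intros u0 v0 Hi.
    rewrite <- (Cmult_1_l (a1 (u0 + v0))).
    split; [apply (is_deriveC_comp a (fun y => u0 + y) v0 1) | apply (is_deriveC_comp a (fun y => y + v0) u0 1)];
      try apply (dp_derive _ _ _ _ _ DP), Hsum, Hi; auto_derive; trivial. }
  intros Huv.
  set (P := fun u v => Cminus (Cplus (Hu u v) (Mu u v)) (Cmult (a (u + v)) (Cminus (H u v) (M u v)))).
  set (Q := fun u v => Cminus (Cminus (Hv u v) (Mv u v)) (Cmult (a (u + v)) (Cplus (H u v) (M u v)))).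
  assert (HPQ : P u v = RtoC 0 /\ Q u v = RtoC 0).
  { apply (goursat_system_zero b P Q (fun u v => Copp (a (u + v)))); trivial.
    - intros u0 v0 Hi.
      apply continuousC_minus; [apply continuousC_plus | apply continuousC_mult; [apply CA, Hi | apply continuousC_minus]].
      + apply (rg_cont_u _ _ _ _ _ _ RH), Hi.
      + apply (rg_cont_u _ _ _ _ _ _ RM), Hi.
      + apply (rg_cont _ _ _ _ _ _ RH), Hi.
      + apply (rg_cont _ _ _ _ _ _ RM), Hi.
    - intros u0 v0 Hi.
      apply continuousC_minus; [apply continuousC_minus | apply continuousC_mult; [apply CA, Hi | apply continuousC_plus]].
      + apply (rg_cont_v _ _ _ _ _ _ RH), Hi.
      + apply (rg_cont_v _ _ _ _ _ _ RM), Hi.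
      + apply (rg_cont _ _ _ _ _ _ RH), Hi.
      + apply (rg_cont _ _ _ _ _ _ RM), Hi.
    - intros u0 v0 Hi. apply continuousC_opp, CA, Hi.
    - intros u0 v0 Hi. evar_last.
      + apply is_deriveC_minus; [apply is_deriveC_plus | apply is_deriveC_mult; [apply (Da u0 v0 Hi) | apply is_deriveC_minus]].
        * apply (rg_uv _ _ _ _ _ _ RH), Hi.
        * apply (rg_uv _ _ _ _ _ _ RM), Hi.
        * apply (rg_v _ _ _ _ _ _ RH), Hi.
        * apply (rg_v _ _ _ _ _ _ RM), Hi.
      + C_eq. unfold Q. rewrite (dp_q _ _ _ _ _ DP), (dp_p _ _ _ _ _ DP) by (apply Hsum, Hi). ring.
    - intros u0 v0 Hi. evar_last.
      + apply is_deriveC_minus; [apply is_deriveC_minus | apply is_deriveC_mult; [apply (Da u0 v0 Hi) | apply is_deriveC_plus]].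
        * apply (rg_vu _ _ _ _ _ _ RH), Hi.
        * apply (rg_vu _ _ _ _ _ _ RM), Hi.
        * apply (rg_u _ _ _ _ _ _ RH), Hi.
        * apply (rg_u _ _ _ _ _ _ RM), Hi.
      + C_eq. unfold P. rewrite (dp_q _ _ _ _ _ DP), (dp_p _ _ _ _ _ DP) by (apply Hsum, Hi). ring.
    - intros u0 Hu0. unfold P. rewrite (darboux_kernel_axis u0 Hu0), Rplus_0_r.
      rewrite (rg_u0 _ _ _ _ _ _ RH), (rg_u0 _ _ _ _ _ _ RM) by assumption.
      rewrite (dp_q _ _ _ _ _ DP), (dp_p _ _ _ _ _ DP) by assumption.
      field.
    - intros v0 Hv0. unfold Q. rewrite (rg_v0 _ _ _ _ _ _ RH), (rg_v0 _ _ _ _ _ _ RM) by assumption.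
      rewrite (rg_0v _ _ _ _ _ _ RH), (rg_0v _ _ _ _ _ _ RM) by assumption.
      field. }
  destruct HPQ as [E1 E2]. unfold P in E1. unfold Q in E2. split.
  - rewrite <- (Cplus_0_r (Cmult _ _)), <- E1. ring.
  - rewrite <- (Cplus_0_r (Cmult _ _)), <- E2. ring.
Qed.

End DarbouxKernels.

(** * Transmutation operators *)

Definition kernel_RInt (k : R -> R -> C) (g : R -> C) (x : R) : C :=
  CRInt (fun s => Cmult (k ((x + s) / 2) ((x - s) / 2)) (g s)) (- x) x.

Lemma kernel_point_interior (b x s : R) :
  -b < x < b -> -b < s < b -> goursat_interior b ((x + s) / 2) ((x - s) / 2).
Proof. intros; apply goursat_interior_iff; lra. Qed.

Lemma symmetric_interval (b x s : R) :
  -b < x < b -> Rmin (- x) x <= s <= Rmax (- x) x -> -b < s < b.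
Proof. intros Hx. unfold Rmin, Rmax; destruct Rle_dec; lra. Qed.

Lemma symmetric_interval_thick (b x : R) :
  -b < x < b -> exists e : posreal, forall y s, Rabs (y - x) < e ->
    Rmin (- x) x - e < s < Rmax (- x) x + e -> -b < y < b /\ -b < s < b.
Proof.
  intros Hx.
  assert (He : 0 < Rmin (b - x) (b + x)) by (apply Rmin_glb_lt; lra).
  exists (mkposreal _ He); simpl. intros y s Hy Hs.
  pose proof (Rmin_l (b - x) (b + x)). pose proof (Rmin_r (b - x) (b + x)).
  set (e := Rmin (b - x) (b + x)) in *. clearbody e.
  apply Rabs_lt_between in Hy.
  revert Hs. unfold Rmin, Rmax; destruct Rle_dec; lra.
Qed.

Lemma continuous_kernel_slice (b : R) (k : R -> R -> C) (x s : R) :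
  continuous_interior b k -> -b < x < b -> -b < s < b ->
  continuousC (fun s => k ((x + s) / 2) ((x - s) / 2)) s.
Proof.
  intros Hk Hx Hs.
  apply (continuousC2_comp k (fun s => (x + s) / 2) (fun s => (x - s) / 2)).
  - apply Hk, kernel_point_interior; assumption.
  - apply (ex_derive_continuous (V := R_NormedModule)); auto_derive; trivial.
  - apply (ex_derive_continuous (V := R_NormedModule)); auto_derive; trivial.
Qed.

(** Differentiating the kernel needs no regularity of g beyond continuity. The end
    points s = -x and s = x correspond to the axes u = 0 and v = 0. *)
Lemma is_deriveC_kernel_RInt (b : R) (q : R -> C) (h : C) (H Hu Hv : R -> R -> C)
  (g : R -> C) (x : R) :
  regular_goursat b q h H Hu Hv ->
  (forall s, -b < s < b -> continuousC g s) -> -b < x < b ->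
  is_deriveC (kernel_RInt H g) x
    (Cplus (kernel_RInt (fun u v => Cdiv (Cplus (Hu u v) (Hv u v)) (RtoC 2)) g x)
      (Cplus (Cmult (H 0 x) (g (- x))) (Cmult (H x 0) (g x)))).
Proof.
  intros RH Hg Hx. unfold kernel_RInt. evar_last.
  - apply (is_deriveC_CRInt_param
      (fun y s => Cmult (H ((y + s) / 2) ((y - s) / 2)) (g s))
      (fun y s => Cmult (Cdiv (Cplus (Hu ((y + s) / 2) ((y - s) / 2)) (Hv ((y + s) / 2) ((y - s) / 2))) (RtoC 2)) (g s))
      (fun y => - y) (fun y => y) x (Ropp 1) 1).
    + auto_derive; trivial; ring.
    + auto_derive; trivial; ring.
    + destruct (symmetric_interval_thick b x Hx) as [e He]. exists e.
      intros y s Hy Hs. destruct (He y s Hy Hs) as [Hyb Hsb].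
      assert (Hi := kernel_point_interior b y s Hyb Hsb).
      split; [ | split].
      * evar_last.
        -- apply is_deriveC_mult; [ | apply is_deriveC_const].
           apply (regular_goursat_comp b q h H Hu Hv (fun y => (y + s) / 2) (fun y => (y - s) / 2) y (/ 2) (/ 2) RH Hi);
             auto_derive; trivial; field.
        -- C_eq. rewrite RtoC_inv by lra. field.
      * apply continuousC_mult; [apply (continuous_kernel_slice b) | apply Hg]; trivial.
        apply (rg_cont _ _ _ _ _ _ RH).
      * assert (H1 : continuous (T := R2) (fun z => (fst z + snd z) / 2) (y, s)).
        { apply (continuous_mult (K := R_AbsRing)); [ | apply continuous_const].
          apply continuous_Rplus; [apply continuous_fst_at | apply continuous_snd_at]. }
        assert (H2 : continuous (T := R2) (fun z => (fst z - snd z) / 2) (y, s)).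
        { apply (continuous_mult (K := R_AbsRing)); [ | apply continuous_const].
          apply (continuous_minus (V := R_NormedModule)); [apply continuous_fst_at | apply continuous_snd_at]. }
        apply continuousC_mult; [apply continuousC_mult; [apply continuousC_plus | apply continuousC_const] | ].
        -- apply (continuousC2_comp (T := R2) Hu (fun z => (fst z + snd z) / 2) (fun z => (fst z - snd z) / 2)); trivial.
           apply (rg_cont_u _ _ _ _ _ _ RH), Hi.
        -- apply (continuousC2_comp (T := R2) Hv (fun z => (fst z + snd z) / 2) (fun z => (fst z - snd z) / 2)); trivial.
           apply (rg_cont_v _ _ _ _ _ _ RH), Hi.
        -- apply (continuousC_comp (T := R2) (S := R_UniformSpace) (y, s) snd g); [apply continuous_snd_at | apply Hg, Hsb].
  - C_eq. cbv beta.
    replace ((x + - x) / 2) with 0 by field. replace ((x - - x) / 2) with x by field.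
    replace ((x + x) / 2) with x by field. replace ((x - x) / 2) with 0 by field.
    rewrite RtoC_opp. ring.
Qed.

Lemma CRInt_plus (g1 g2 : R -> C) (a c : R) :
  (forall s, Rmin a c <= s <= Rmax a c -> continuousC g1 s) ->
  (forall s, Rmin a c <= s <= Rmax a c -> continuousC g2 s) ->
  CRInt (fun s => Cplus (g1 s) (g2 s)) a c = Cplus (CRInt g1 a c) (CRInt g2 a c).
Proof.
  intros H1 H2.
  exact (RInt_plus (V := C_R_CompleteNormedModule) g1 g2 a c
    (ex_CRInt_continuous g1 a c H1) (ex_CRInt_continuous g2 a c H2)).
Qed.

Lemma CRInt_ext (g1 g2 : R -> C) (a c : R) :
  (forall s, Rmin a c < s < Rmax a c -> g1 s = g2 s) -> CRInt g1 a c = CRInt g2 a c.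
Proof. exact (RInt_ext (V := C_R_CompleteNormedModule) g1 g2 a c). Qed.

Lemma CRInt_scal (c : C) (g : R -> C) (a d : R) :
  (forall s, Rmin a d <= s <= Rmax a d -> continuousC g s) ->
  CRInt (fun s => Cmult c (g s)) a d = Cmult c (CRInt g a d).
Proof.
  intros Hg.
  assert (Hre : ex_RInt (fun s => Re (g s)) a d).
  { apply (ex_RInt_continuous (V := R_CompleteNormedModule)). intros s Hs.
    apply (continuous_C_iff g s), Hg, Hs. }
  assert (Him : ex_RInt (fun s => Im (g s)) a d).
  { apply (ex_RInt_continuous (V := R_CompleteNormedModule)). intros s Hs.
    apply (continuous_C_iff g s), Hg, Hs. }
  rewrite !CRInt_pair.
  2: apply ex_CRInt_continuous; exact Hg.
  2: apply ex_CRInt_continuous; intros s Hs; apply continuousC_mult; [apply continuousC_const | apply Hg, Hs].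
  assert (Hsc : forall (r : R) (k : R -> R), ex_RInt k a d ->
    ex_RInt (fun s => r * k s) a d /\ RInt (fun s => r * k s) a d = r * RInt k a d).
  { intros r k Hk. split; [exact (ex_RInt_scal (V := R_NormedModule) k a d r Hk)
    | exact (RInt_scal (V := R_CompleteNormedModule) k a d r Hk)]. }
  apply injective_projections; simpl.
  - transitivity (RInt (fun s => Re c * Re (g s)) a d - RInt (fun s => Im c * Im (g s)) a d).
    + apply (RInt_minus (V := R_CompleteNormedModule)
        (fun s => Re c * Re (g s)) (fun s => Im c * Im (g s))); apply Hsc; assumption.
    + rewrite (proj2 (Hsc (Re c) _ Hre)), (proj2 (Hsc (Im c) _ Him)). reflexivity.
  - transitivity (RInt (fun s => Re c * Im (g s)) a d + RInt (fun s => Im c * Re (g s)) a d).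
    + apply (RInt_plus (V := R_CompleteNormedModule)
        (fun s => Re c * Im (g s)) (fun s => Im c * Re (g s))); apply Hsc; assumption.
    + rewrite (proj2 (Hsc (Re c) _ Him)), (proj2 (Hsc (Im c) _ Hre)). reflexivity.
Qed.

Lemma kernel_RInt_scal (b : R) (c : C) (k : R -> R -> C) (g : R -> C) (x : R) :
  continuous_interior b k ->
  (forall s, -b < s < b -> continuousC g s) -> -b < x < b ->
  kernel_RInt (fun u v => Cmult c (k u v)) g x = Cmult c (kernel_RInt k g x).
Proof.
  intros H1 Hg Hx. unfold kernel_RInt. rewrite <- CRInt_scal.
  - apply CRInt_ext. intros; ring.
  - intros s Hs. apply (symmetric_interval b x) in Hs; trivial.
    apply continuousC_mult; [apply (continuous_kernel_slice b) | apply Hg]; trivial.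
Qed.

Lemma kernel_RInt_plus (b : R) (k1 k2 : R -> R -> C) (g : R -> C) (x : R) :
  continuous_interior b k1 -> continuous_interior b k2 ->
  (forall s, -b < s < b -> continuousC g s) -> -b < x < b ->
  kernel_RInt (fun u v => Cplus (k1 u v) (k2 u v)) g x =
  Cplus (kernel_RInt k1 g x) (kernel_RInt k2 g x).
Proof.
  intros H1 H2 Hg Hx. unfold kernel_RInt. rewrite <- CRInt_plus.
  - apply CRInt_ext. intros; ring.
  - intros s Hs. apply (symmetric_interval b x) in Hs; trivial.
    apply continuousC_mult; [apply (continuous_kernel_slice b) | apply Hg]; trivial.
  - intros s Hs. apply (symmetric_interval b x) in Hs; trivial.
    apply continuousC_mult; [apply (continuous_kernel_slice b) | apply Hg]; trivial.
Qed.

Lemma kernel_RInt_ext (b : R) (k1 k2 : R -> R -> C) (g1 g2 : R -> C) (x : R) :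
  -b < x < b ->
  (forall u v, goursat_interior b u v -> u + v = x -> k1 u v = k2 u v) ->
  (forall s, -b < s < b -> g1 s = g2 s) ->
  kernel_RInt k1 g1 x = kernel_RInt k2 g2 x.
Proof.
  intros Hx Hk Hg. apply CRInt_ext. intros s Hs.
  assert (Hsb : -b < s < b) by (apply (symmetric_interval b x); trivial; lra).
  rewrite Hk, Hg; trivial; [ | field]. apply kernel_point_interior; trivial.
Qed.

Lemma kernel_RInt_by_parts (b : R) (p : R -> C) (h : C) (M Mu Mv : R -> R -> C)
  (g g1 : R -> C) (x : R) :
  regular_goursat b p h M Mu Mv ->
  (forall s, -b < s < b -> is_deriveC g s (g1 s)) ->
  (forall s, -b < s < b -> continuousC g1 s) -> -b < x < b ->
  Cplus (kernel_RInt M g1 x)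
    (kernel_RInt (fun u v => Cdiv (Cminus (Mu u v) (Mv u v)) (RtoC 2)) g x) =
  Cminus (Cmult (M x 0) (g x)) (Cmult (M 0 x) (g (- x))).
Proof.
  intros RM Hg Hg1 Hx. unfold kernel_RInt.
  assert (Cg : forall s, -b < s < b -> continuousC g s).
  { intros s Hs. apply (is_deriveC_continuous g s (g1 s)), Hg, Hs. }
  assert (CK : continuous_interior b (fun u v => Cdiv (Cminus (Mu u v) (Mv u v)) (RtoC 2))).
  { intros u v Hi. apply continuousC_mult; [apply continuousC_minus | apply continuousC_const].
    - apply (rg_cont_u _ _ _ _ _ _ RM), Hi.
    - apply (rg_cont_v _ _ _ _ _ _ RM), Hi. }
  assert (C1 : forall s, -b < s < b -> continuousC (fun s => Cmult (M ((x + s) / 2) ((x - s) / 2)) (g1 s)) s).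
  { intros s Hs. apply continuousC_mult; [apply (continuous_kernel_slice b) | apply Hg1]; trivial.
    apply (rg_cont _ _ _ _ _ _ RM). }
  assert (C2 : forall s, -b < s < b -> continuousC (fun s =>
    Cmult (Cdiv (Cminus (Mu ((x + s) / 2) ((x - s) / 2)) (Mv ((x + s) / 2) ((x - s) / 2))) (RtoC 2))
      (g s)) s).
  { intros s Hs. apply continuousC_mult; [ | apply Cg; trivial].
    apply (continuous_kernel_slice b (fun u v => Cdiv (Cminus (Mu u v) (Mv u v)) (RtoC 2))); trivial. }
  rewrite <- CRInt_plus.
  2, 3: intros s Hs; apply (symmetric_interval b x) in Hs; trivial; auto.
  rewrite (CRInt_derive (fun s => Cmult (M ((x + s) / 2) ((x - s) / 2)) (g s))).
  - replace ((x + - x) / 2) with 0 by field. replace ((x - - x) / 2) with x by field.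
    replace ((x + x) / 2) with x by field. replace ((x - x) / 2) with 0 by field. reflexivity.
  - intros s Hs. apply (symmetric_interval b x) in Hs; trivial. evar_last.
    + apply is_deriveC_mult; [ | apply Hg, Hs].
      apply (regular_goursat_comp b p h M Mu Mv (fun s => (x + s) / 2) (fun s => (x - s) / 2) s (/ 2) (- / 2) RM);
        [apply kernel_point_interior; trivial | | ]; auto_derive; trivial; field.
    + C_eq. rewrite RtoC_opp, RtoC_inv by lra. field.
  - intros s Hs. apply (symmetric_interval b x) in Hs; trivial.
    apply continuousC_plus; auto.
Qed.

(** The commutation relation (d - a) T_H g = T_M g'. Moving the derivative off g1 by
    parts, the integrands cancel by the sum of the two equations of
    [darboux_kernel_system], and the boundary terms by the values of the kernels on the
    axes. *)
Lemma is_deriveC_transmutation (b : R) (a a1 q p : R -> C) (H Hu Hv M Mu Mv : R -> R -> C)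
  (g g1 : R -> C) (x : R) :
  0 < b -> darboux_pair b a a1 q p ->
  regular_goursat b q (a 0) H Hu Hv -> regular_goursat b p (Copp (a 0)) M Mu Mv ->
  (forall s, -b < s < b -> is_deriveC g s (g1 s)) ->
  (forall s, -b < s < b -> continuousC g1 s) -> -b < x < b ->
  is_deriveC (transmutation H g) x
    (Cplus (Cmult (a x) (transmutation H g x)) (transmutation M g1 x)).
Proof.
  intros hb DP RH RM Hg Hg1 Hx.
  assert (Cg : forall s, -b < s < b -> continuousC g s).
  { intros s Hs. apply (is_deriveC_continuous g s (g1 s)), Hg, Hs. }
  evar_last.
  - apply is_deriveC_plus; [apply Hg, Hx | apply (is_deriveC_kernel_RInt b q (a 0) H Hu Hv g x RH Cg Hx)].
  - C_eq. unfold transmutation. fold (kernel_RInt H g x) (kernel_RInt M g1 x).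
    assert (EM := kernel_RInt_by_parts b p _ M Mu Mv g g1 x RM Hg Hg1 Hx).
    assert (Cplus (kernel_RInt (fun u v => Cdiv (Cplus (Hu u v) (Hv u v)) (RtoC 2)) g x)
      (kernel_RInt (fun u v => Cdiv (Cminus (Mu u v) (Mv u v)) (RtoC 2)) g x) = Cmult (a x) (kernel_RInt H g x)) as EK.
    { rewrite <- (kernel_RInt_plus b); trivial.
      - rewrite <- (kernel_RInt_scal b); trivial; [ | apply (rg_cont _ _ _ _ _ _ RH)].
        apply (kernel_RInt_ext b); trivial. intros u v Hi <-.
        destruct (darboux_kernel_system b a a1 q p H Hu Hv M Mu Mv hb DP RH RM u v Hi) as [E1 E2].
        replace (Cplus (Cdiv (Cplus (Hu u v) (Hv u v)) (RtoC 2)) (Cdiv (Cminus (Mu u v) (Mv u v)) (RtoC 2)))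
          with (Cdiv (Cplus (Cplus (Hu u v) (Mu u v)) (Cminus (Hv u v) (Mv u v))) (RtoC 2)) by field.
        rewrite E1, E2. field.
      - intros u v Hi. apply continuousC_mult; [apply continuousC_plus | apply continuousC_const].
        + apply (rg_cont_u _ _ _ _ _ _ RH), Hi.
        + apply (rg_cont_v _ _ _ _ _ _ RH), Hi.
      - intros u v Hi. apply continuousC_mult; [apply continuousC_minus | apply continuousC_const].
        + apply (rg_cont_u _ _ _ _ _ _ RM), Hi.
        + apply (rg_cont_v _ _ _ _ _ _ RM), Hi. }
    assert (EA := darboux_kernel_axis b a a1 q p H Hu Hv M Mu Mv hb DP RH RM x Hx).
    rewrite (rg_0v _ _ _ _ _ _ RM) in EM by trivial.
    rewrite (rg_0v _ _ _ _ _ _ RH) by trivial.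
    set (I1 := kernel_RInt (fun u v => Cdiv (Cplus (Hu u v) (Hv u v)) (RtoC 2)) g x) in *.
    set (I2 := kernel_RInt (fun u v => Cdiv (Cminus (Mu u v) (Mv u v)) (RtoC 2)) g x) in *.
    rewrite Cmult_plus_distr_l, <- EK.
    replace (kernel_RInt M g1 x) with
      (Cminus (Cplus (kernel_RInt M g1 x) I2) I2) by ring.
    rewrite EM, <- EA. field.
Qed.

Definition continuous_square (b : R) (G : R -> R -> C) : Prop :=
  forall x t, square b x t -> continuousC2 (fun p => G (fst p) (snd p)) (x, t).

Lemma square_locally (b x t : R) :
  square b x t -> locally (T := R2) (x, t) (fun p => square b (fst p) (snd p)).
Proof.
  intros [Hx Ht].
  assert (He : 0 < Rmin (Rmin (b - x) (b + x)) (Rmin (b - t) (b + t))).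
  { repeat apply Rmin_glb_lt; lra. }
  exists (mkposreal _ He). intros [y s] [Hy Hs]; simpl in *.
  apply Rabs_lt_between in Hy. apply Rabs_lt_between in Hs.
  unfold minus, plus, opp in *; simpl in *.
  pose proof (Rmin_l (Rmin (b - x) (b + x)) (Rmin (b - t) (b + t))).
  pose proof (Rmin_r (Rmin (b - x) (b + x)) (Rmin (b - t) (b + t))).
  pose proof (Rmin_l (b - x) (b + x)). pose proof (Rmin_r (b - x) (b + x)).
  pose proof (Rmin_l (b - t) (b + t)). pose proof (Rmin_r (b - t) (b + t)).
  unfold square; lra.
Qed.

Lemma continuous_square_slice (b : R) (G : R -> R -> C) (x t : R) :
  continuous_square b G -> square b x t -> continuousC (fun s => G s t) x.
Proof.
  intros HG Hs. apply (continuousC2_comp G (fun s => s) (fun _ => t)).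
  - apply HG, Hs.
  - apply continuous_id.
  - apply continuous_const.
Qed.

Lemma continuous_kernel_comp {T : UniformSpace} (b : R) (k : R -> R -> C) (r1 r2 : T -> R) (z : T) :
  continuous_interior b k -> -b < r1 z < b -> -b < r2 z < b ->
  continuous r1 z -> continuous r2 z ->
  continuousC (fun z => k ((r1 z + r2 z) / 2) ((r1 z - r2 z) / 2)) z.
Proof.
  intros Hk H1 H2 C1 C2.
  apply (continuousC2_comp k (fun z => (r1 z + r2 z) / 2) (fun z => (r1 z - r2 z) / 2)).
  - apply Hk, kernel_point_interior; assumption.
  - apply (continuous_mult (K := R_AbsRing)); [ | apply continuous_const].
    apply continuous_Rplus; assumption.
  - apply (continuous_mult (K := R_AbsRing)); [ | apply continuous_const].
    apply (continuous_minus (V := R_NormedModule)); assumption.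
Qed.

Lemma continuous_square_kernel_RInt (b : R) (k g : R -> R -> C) :
  continuous_interior b k -> continuous_square b g ->
  continuous_square b (fun x t => kernel_RInt k (fun s => g s t) x).
Proof.
  intros Hk Hg x t Hs. unfold kernel_RInt.
  apply (continuous_CRInt_param (T := R2)
    (fun p s => Cmult (k ((fst p + s) / 2) ((fst p - s) / 2)) (g s (snd p)))
    (fun p => - fst p) fst).
  generalize (square_locally b x t Hs). apply filter_imp. intros p [Hp1 Hp2].
  split; [ | split; [apply continuous_fst_at | ]].
  { apply (continuous_opp (V := R_NormedModule)), continuous_fst_at. }
  intros s Hs'. assert (Hsb := symmetric_interval b (fst p) s Hp1 Hs').
  apply continuousC_mult.
  - apply (continuous_kernel_comp (T := prod_UniformSpace R2 R_UniformSpace) b k (fun z => fst (fst z)) snd); trivial.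
    + apply continuous_fst_fst.
    + apply continuous_snd_at.
  - apply (continuousC2_comp (T := prod_UniformSpace R2 R_UniformSpace) g snd (fun z => snd (fst z))).
    + apply Hg; split; assumption.
    + apply continuous_snd_at.
    + apply continuous_snd_fst.
Qed.

Lemma is_deriveC_kernel_RInt_t (b : R) (k g gt : R -> R -> C) (x t : R) :
  continuous_interior b k -> square b x t ->
  (forall s r, square b s r -> is_deriveC (fun r => g s r) r (gt s r)) ->
  continuous_square b g -> continuous_square b gt ->
  is_deriveC (fun r => kernel_RInt k (fun s => g s r) x) t (kernel_RInt k (fun s => gt s t) x).
Proof.
  intros Hk [Hx Ht] Hg Cg Cgt. unfold kernel_RInt. evar_last.
  - apply (is_deriveC_CRInt_param
      (fun r s => Cmult (k ((x + s) / 2) ((x - s) / 2)) (g s r))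
      (fun r s => Cmult (k ((x + s) / 2) ((x - s) / 2)) (gt s r))
      (fun _ => - x) (fun _ => x) t 0 0).
    + apply (is_derive_const (V := R_NormedModule)).
    + apply (is_derive_const (V := R_NormedModule)).
    + destruct (symmetric_interval_thick b x Hx) as [e He].
      destruct (symmetric_interval_thick b t Ht) as [e' He'].
      assert (Hm : 0 < Rmin e e') by (apply Rmin_glb_lt; apply cond_pos).
      exists (mkposreal _ Hm); simpl. intros r s Hr Hs.
      pose proof (Rmin_l e e'). pose proof (Rmin_r e e').
      assert (Hsb : -b < s < b).
      { apply (He x s); [rewrite Rminus_diag, Rabs_R0; apply cond_pos | lra]. }
      assert (Hrb : -b < r < b).
      { apply (He' r t); [lra | ]. pose proof (cond_pos e').
        unfold Rmin, Rmax; destruct Rle_dec; lra. }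
      split; [ | split].
      * evar_last.
        -- apply is_deriveC_mult; [apply is_deriveC_const | apply Hg; split; assumption].
        -- C_eq; ring.
      * apply continuousC_mult; [apply (continuous_kernel_slice b); trivial | ].
        apply (continuous_square_slice b g); trivial; split; assumption.
      * apply continuousC_mult.
        -- apply (continuous_kernel_comp (T := R2) b k (fun _ => x) snd); trivial.
           ++ apply continuous_const.
           ++ apply continuous_snd_at.
        -- apply (continuousC2_comp (T := R2) gt snd fst).
           ++ apply Cgt; split; assumption.
           ++ apply continuous_snd_at.
           ++ apply continuous_fst_at.
  - C_eq. cbv beta. ring.
Qed.

Record C1_scalar (b : R) (g gx gt : R -> R -> C) : Prop := {
  c1_x : forall x t, square b x t -> is_deriveC (fun y => g y t) x (gx x t);
  c1_t : forall x t, square b x t -> is_deriveC (fun y => g x y) t (gt x t);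
  c1_cont : continuous_square b g;
  c1_cont_x : continuous_square b gx;
  c1_cont_t : continuous_square b gt
}.

Lemma continuous_square_transmutation (b : R) (H g : R -> R -> C) :
  continuous_interior b H -> continuous_square b g ->
  continuous_square b (fun x t => transmutation H (fun s => g s t) x).
Proof.
  intros CH Cg x t Hs. apply continuousC_plus; [apply Cg, Hs | ].
  apply (continuous_square_kernel_RInt b H g CH Cg x t Hs).
Qed.

Lemma C1_scalar_transmutation (b : R) (a a1 q p : R -> C) (H Hu Hv M Mu Mv : R -> R -> C)
  (g gx gt : R -> R -> C) :
  0 < b -> darboux_pair b a a1 q p ->
  regular_goursat b q (a 0) H Hu Hv -> regular_goursat b p (Copp (a 0)) M Mu Mv ->
  C1_scalar b g gx gt ->
  C1_scalar b (fun x t => transmutation H (fun s => g s t) x)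
    (fun x t => Cplus (Cmult (a x) (transmutation H (fun s => g s t) x))
      (transmutation M (fun s => gx s t) x))
    (fun x t => transmutation H (fun s => gt s t) x).
Proof.
  intros hb DP RH RM [D1 D2 C0 C1 C2].
  assert (CH := rg_cont _ _ _ _ _ _ RH). assert (CM := rg_cont _ _ _ _ _ _ RM).
  constructor.
  - intros x t [Hx Ht]. apply (is_deriveC_transmutation b a a1 q p H Hu Hv M Mu Mv
      (fun s => g s t) (fun s => gx s t)); trivial.
    + intros s Hs. apply D1; split; assumption.
    + intros s Hs. apply (continuous_square_slice b gx); trivial; split; assumption.
  - intros x t Hs. apply is_deriveC_plus; [apply D2, Hs | ].
    apply (is_deriveC_kernel_RInt_t b H g gt); assumption.
  - apply continuous_square_transmutation; assumption.
  - intros x t Hs. apply continuousC_plus; [apply continuousC_mult | ].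
    + apply (continuousC_comp (T := R2) (S := R_UniformSpace) (x, t) fst a); [apply continuous_fst_at | ].
      apply (is_deriveC_continuous a x (a1 x)), (dp_derive _ _ _ _ _ DP), Hs.
    + exact (continuous_square_transmutation b H g CH C0 x t Hs).
    + exact (continuous_square_transmutation b M gx CM C1 x t Hs).
  - apply continuous_square_transmutation; assumption.
Qed.

(** T_H g - g is an integral with a C^1 kernel, hence differentiable for a continuous g;
    so g is as differentiable in x as T_H g. *)
Lemma derive_x_of_transmutation (b : R) (q : R -> C) (h : C) (H Hu Hv : R -> R -> C)
  (g Ux : R -> R -> C) :
  0 < b -> regular_goursat b q h H Hu Hv -> continuous_square b g ->
  (forall x t, square b x t ->
     is_deriveC (transmutation H (fun s => g s t)) x (Ux x t)) ->
  continuous_square b Ux ->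
  exists gx, (forall x t, square b x t -> is_deriveC (fun y => g y t) x (gx x t)) /\
    continuous_square b gx.
Proof.
  intros hb RH Cg HU CU.
  assert (CK : continuous_interior b (fun u v => Cdiv (Cplus (Hu u v) (Hv u v)) (RtoC 2))).
  { intros u v Hi. apply continuousC_mult; [apply continuousC_plus | apply continuousC_const].
    - apply (rg_cont_u _ _ _ _ _ _ RH), Hi.
    - apply (rg_cont_v _ _ _ _ _ _ RH), Hi. }
  exists (fun x t => Cminus (Ux x t)
    (Cplus (kernel_RInt (fun u v => Cdiv (Cplus (Hu u v) (Hv u v)) (RtoC 2)) (fun s => g s t) x)
      (Cplus (Cmult (H 0 x) (g (- x) t)) (Cmult (H x 0) (g x t))))).
  split.
  - intros x t Hs.
    apply (is_derive_ext (V := C_R_NormedModule)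
      (fun y => Cminus (transmutation H (fun s => g s t) y) (kernel_RInt H (fun s => g s t) y))).
    { intros y. C_eq. unfold transmutation. fold (kernel_RInt H (fun s => g s t) y). ring. }
    apply is_deriveC_minus; [apply HU, Hs | ].
    apply (is_deriveC_kernel_RInt b q h H Hu Hv (fun s => g s t)); trivial; [ | apply Hs].
    intros s Hs'. apply (continuous_square_slice b g); trivial. split; [trivial | apply Hs].
  - intros x t Hs. destruct Hs as [Hx Ht].
    assert (CH := rg_cont _ _ _ _ _ _ RH).
    apply continuousC_minus; [apply CU; split; assumption | apply continuousC_plus; [ | apply continuousC_plus]].
    + apply (continuous_square_kernel_RInt b _ g CK Cg); split; assumption.
    + apply continuousC_mult.
      * apply (continuousC2_comp (T := R2) H (fun _ => 0) fst); [ | apply continuous_const | apply continuous_fst_at].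
        apply CH, goursat_interior_iff; simpl; lra.
      * apply (continuousC2_comp (T := R2) g (fun p => - fst p) snd).
        -- apply Cg; split; simpl; lra.
        -- apply (continuous_opp (V := R_NormedModule)), continuous_fst_at.
        -- apply continuous_snd_at.
    + apply continuousC_mult.
      * apply (continuousC2_comp (T := R2) H fst (fun _ => 0)); [ | apply continuous_fst_at | apply continuous_const].
        apply CH, goursat_interior_iff; simpl; lra.
      * apply Cg; split; assumption.
Qed.

(** * Hyperbolic analytic functions as travelling waves *)

Definition wave_fun (P Q : R -> C) (x t : R) : B :=
  (Cplus (P (x + t)) (Q (x - t)), Cminus (P (x + t)) (Q (x - t))).

Definition wave (b : R) (P Q : R -> C) (w : R -> R -> B) : Prop :=
  forall x t, square b x t -> w x t = wave_fun P Q x t.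

Definition C1_profile (b : R) (P P1 : R -> C) : Prop :=
  forall s, - (2 * b) < s < 2 * b -> is_deriveC P s (P1 s) /\ continuousC P1 s.

Lemma C1_scalar_of_partials (b : R) (g gx gt : R -> R -> C) :
  (forall x t, square b x t ->
     is_deriveC (fun y => g y t) x (gx x t) /\ is_deriveC (fun y => g x y) t (gt x t)) ->
  continuous_square b gx -> continuous_square b gt -> C1_scalar b g gx gt.
Proof.
  intros Hd Cx Ct. constructor; trivial; try (intros x t Hs; apply Hd, Hs).
  intros x t Hs.
  assert (Hreal : forall (r rx : R -> R -> R) (rt : R),
    locally (T := R2) (x, t) (fun p => is_derive (fun y => r y (snd p)) (fst p) (rx (fst p) (snd p))) ->
    is_derive (fun y => r x y) t rt ->
    continuous (T := R2) (fun p => rx (fst p) (snd p)) (x, t) ->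
    continuous (T := R2) (fun p => r (fst p) (snd p)) (x, t)).
  { intros r rx rt A1 A2 A3.
    apply (filterdiff_continuous (U := prod_NormedModule R_AbsRing R_NormedModule R_NormedModule)
      (V := R_NormedModule) (fun p => r (fst p) (snd p)) (x, t)).
    eexists. exact (is_derive_filterdiff r x t rx rt A1 A2 A3). }
  assert (Hl : locally (T := R2) (x, t) (fun p =>
    is_deriveC (fun y => g y (snd p)) (fst p) (gx (fst p) (snd p)))).
  { generalize (square_locally b x t Hs). apply filter_imp. intros p Hp; apply Hd, Hp. }
  destruct (Hd x t Hs) as [_ Hdt]. apply is_derive_C_iff in Hdt.
  assert (Hcx := proj1 (continuous_C_iff _ _) (Cx x t Hs)).
  apply continuous_C_iff; split.
  - apply (Hreal (fun x t => Re (g x t)) (fun x t => Re (gx x t)) (Re (gt x t))); try tauto.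
    revert Hl; apply filter_imp; intros p Hp. apply is_derive_C_iff in Hp; tauto.
  - apply (Hreal (fun x t => Im (g x t)) (fun x t => Im (gx x t)) (Im (gt x t))); try tauto.
    revert Hl; apply filter_imp; intros p Hp. apply is_derive_C_iff in Hp; tauto.
Qed.

Lemma continuous_on_square_iff (b : R) (g : R -> R -> B) :
  continuous_on (T := R2) (U := B_NormedModule)
    (fun p => square b (fst p) (snd p)) (fun p => g (fst p) (snd p)) <->
  continuous_square b (fun x t => fst (g x t)) /\
  continuous_square b (fun x t => snd (g x t)).
Proof.
  assert (Hpair : forall x t,
    continuous (T := R2) (U := prod_UniformSpace C_UniformSpace C_UniformSpace)
      (fun p => g (fst p) (snd p)) (x, t) <->
    continuousC2 (fun p => fst (g (fst p) (snd p))) (x, t) /\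
    continuousC2 (fun p => snd (g (fst p) (snd p))) (x, t)).
  { intros x t. exact (filterlim_pair_iff (U := C_UniformSpace) (V := C_UniformSpace)
      (locally (T := R2) (x, t)) (fun p => g (fst p) (snd p)) (g x t)). }
  split.
  - intros H. split; intros x t Hs; apply Hpair;
      exact (continuous_on_interior _ _ _ H (square_locally b x t Hs)).
  - intros [H1 H2] [x t] Hs.
    assert (H := proj2 (Hpair x t) (conj (H1 x t Hs) (H2 x t Hs))).
    intros D HD. generalize (H D HD). unfold filtermap, within.
    apply filter_imp. intros p Hp _; exact Hp.
Qed.

Lemma C1_square_iff (b : R) (w wx wt : R -> R -> B) :
  C1_square b w wx wt <->
  C1_scalar b (fun x t => fst (w x t)) (fun x t => fst (wx x t)) (fun x t => fst (wt x t)) /\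
  C1_scalar b (fun x t => snd (w x t)) (fun x t => snd (wx x t)) (fun x t => snd (wt x t)).
Proof.
  unfold C1_square. rewrite !continuous_on_square_iff. split.
  - intros [Hd [[H1 H2] [H3 H4]]].
    split; apply C1_scalar_of_partials; trivial; intros x t Hs;
      destruct (Hd x t Hs) as [A1 A2]; rewrite is_derive_B_iff in A1, A2; tauto.
  - intros [[A1 A2 _ A4 A5] [B1 B2 _ B4 B5]]. split; [ | tauto].
    intros x t Hs; rewrite !is_derive_B_iff. auto.
Qed.

Lemma CRInt_zero (a c : R) : CRInt (fun _ => RtoC 0) a c = RtoC 0.
Proof.
  rewrite (CRInt_derive (fun _ => RtoC 0)).
  - ring.
  - intros; apply is_deriveC_const.
  - intros; apply continuousC_const.
Qed.

(** The sign eps selects the family of characteristics; the reference point on the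
    characteristic through (x, t) is its intersection with the diagonal t = eps x. *)
Lemma transport_constant_on_characteristics (b eps : R) (g gx gt : R -> R -> C) (x t : R) :
  eps = 1 \/ eps = -1 -> C1_scalar b g gx gt ->
  (forall x t, square b x t -> gx x t = Cmult (RtoC eps) (gt x t)) ->
  square b x t ->
  g x t = g ((x + eps * t) / 2) (eps * ((x + eps * t) / 2)).
Proof.
  intros He C1 Hg [Hx Ht].
  set (m := (x + eps * t) / 2). set (d := (x - eps * t) / 2).
  assert (Hsq : forall s, Rmin 0 d <= s <= Rmax 0 d -> square b (m + s) (eps * (m - s))).
  { intros s Hs. assert (Hmd : m = (x + eps * t) / 2 /\ d = (x - eps * t) / 2) by (split; reflexivity).
    clearbody m d. revert Hs. unfold square, Rmin, Rmax.
    destruct He as [-> | ->]; destruct Rle_dec; lra. }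
  assert (E := CRInt_derive (fun s => g (m + s) (eps * (m - s))) (fun _ => RtoC 0) 0 d).
  rewrite CRInt_zero in E.
  assert (E0 : RtoC 0 = Cminus (g (m + d) (eps * (m - d))) (g (m + 0) (eps * (m - 0)))).
  { apply E; [ | intros; apply continuousC_const].
    intros s Hs. assert (Hsqs := Hsq s Hs). evar_last.
    - apply (is_deriveC_comp2 g gx (fun s => m + s) (fun s => eps * (m - s)) s 1 (- eps) (gt (m + s) (eps * (m - s)))).
      + generalize (square_locally b _ _ Hsqs). apply filter_imp.
        intros p Hp. apply (c1_x _ _ _ _ C1), Hp.
      + apply (c1_t _ _ _ _ C1), Hsqs.
      + apply (c1_cont_x _ _ _ _ C1), Hsqs.
      + auto_derive; trivial.
      + auto_derive; trivial. ring.
    - C_eq. rewrite Hg by assumption. rewrite RtoC_opp. ring. }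
  replace (m + d) with x in E0 by (unfold m, d; field).
  replace (eps * (m - d)) with t in E0.
  2:{ unfold m, d. destruct He as [-> | ->]; field. }
  replace (m + 0) with m in E0 by ring. replace (m - 0) with m in E0 by ring.
  replace (g x t) with (Cplus (Cminus (g x t) (g m (eps * m))) (g m (eps * m))) by ring.
  rewrite <- E0. ring.
Qed.

(** Along the horizontal line through the point of the diagonal t = x (respectively
    t = - x) with x = s/2, the combination u + v (respectively u - v) is twice the profile. *)
Lemma wave_C1_profile (b : R) (P Q : R -> C) (w : R -> R -> B) (ux vx : R -> R -> C) :
  wave b P Q w ->
  (forall x t, square b x t -> is_deriveC (fun y => fst (w y t)) x (ux x t)) ->
  (forall x t, square b x t -> is_deriveC (fun y => snd (w y t)) x (vx x t)) ->
  continuous_square b ux -> continuous_square b vx ->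
  exists P1 Q1, C1_profile b P P1 /\ C1_profile b Q Q1.
Proof.
  intros Hw Hu Hv Cu Cv.
  assert (Hnear : forall s, -(2 * b) < s < 2 * b ->
    locally s (fun y => square b (y - s / 2) (s / 2) /\ square b (y - s / 2) (- (s / 2)))).
  { intros s Hs.
    assert (He : 0 < Rmin (b - s / 2) (b + s / 2)) by (apply Rmin_glb_lt; lra).
    exists (mkposreal _ He). intros y Hy. apply Rabs_lt_between in Hy.
    unfold minus, plus, opp in Hy; simpl in Hy.
    pose proof (Rmin_l (b - s / 2) (b + s / 2)). pose proof (Rmin_r (b - s / 2) (b + s / 2)).
    unfold square; lra. }
  assert (Hhalf : forall s, -(2 * b) < s < 2 * b -> square b (s / 2) (s / 2) /\ square b (s / 2) (- (s / 2))).
  { intros s Hs; unfold square; lra. }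
  assert (Chalf : forall (g : R -> R -> C) (r : R) s, continuous_square b g -> square b (s / 2) (r * (s / 2)) ->
    continuousC (fun s => g (s / 2) (r * (s / 2))) s).
  { intros g r s Cg Hs. apply (continuousC2_comp g (fun s => s / 2) (fun s => r * (s / 2))).
    - apply Cg, Hs.
    - apply (ex_derive_continuous (V := R_NormedModule)); auto_derive; trivial.
    - apply (ex_derive_continuous (V := R_NormedModule)); auto_derive; trivial. }
  exists (fun s => Cdiv (Cplus (ux (s / 2) (1 * (s / 2))) (vx (s / 2) (1 * (s / 2)))) (RtoC 2)).
  exists (fun s => Cdiv (Cminus (ux (s / 2) (-1 * (s / 2))) (vx (s / 2) (-1 * (s / 2)))) (RtoC 2)).
  split; intros s Hs; destruct (Hhalf s Hs) as [S1 S2].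
  - replace (1 * (s / 2)) with (s / 2) by ring. split.
    + apply (is_derive_ext_loc (V := C_R_NormedModule)
        (fun y => Cmult (Cplus (fst (w (y - s / 2) (s / 2))) (snd (w (y - s / 2) (s / 2)))) (Cinv (RtoC 2)))).
      { generalize (Hnear s Hs). apply filter_imp. intros y [Hy _]. change R in y.
        C_eq. rewrite (Hw _ _ Hy); simpl. replace (y - s / 2 + s / 2) with y by (R_eq; ring). field. }
      assert (Hshift : is_derive (fun y => y - s / 2) s 1) by (auto_derive; trivial).
      evar_last.
      * apply is_deriveC_mult; [apply is_deriveC_plus | apply is_deriveC_const].
        -- apply (is_deriveC_comp (fun y => fst (w y (s / 2))) (fun y => y - s / 2) s 1); [apply Hu | exact Hshift].
           replace (s - s / 2) with (s / 2) by field. exact S1.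
        -- apply (is_deriveC_comp (fun y => snd (w y (s / 2))) (fun y => y - s / 2) s 1); [apply Hv | exact Hshift].
           replace (s - s / 2) with (s / 2) by field. exact S1.
      * C_eq. replace (s - s / 2) with (s / 2) by field. field.
    + apply continuousC_mult; [apply continuousC_plus | apply continuousC_const];
        apply (Chalf _ 1); trivial; rewrite Rmult_1_l; exact S1.
  - replace (-1 * (s / 2)) with (- (s / 2)) by ring. split.
    + apply (is_derive_ext_loc (V := C_R_NormedModule)
        (fun y => Cmult (Cminus (fst (w (y - s / 2) (- (s / 2)))) (snd (w (y - s / 2) (- (s / 2))))) (Cinv (RtoC 2)))).
      { generalize (Hnear s Hs). apply filter_imp. intros y [_ Hy]. change R in y.
        C_eq. rewrite (Hw _ _ Hy); simpl. replace (y - s / 2 - - (s / 2)) with y by (R_eq; ring). field. }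
      assert (Hshift : is_derive (fun y => y - s / 2) s 1) by (auto_derive; trivial).
      evar_last.
      * apply is_deriveC_mult; [apply is_deriveC_minus | apply is_deriveC_const].
        -- apply (is_deriveC_comp (fun y => fst (w y (- (s / 2)))) (fun y => y - s / 2) s 1); [apply Hu | exact Hshift].
           replace (s - s / 2) with (s / 2) by field. exact S2.
        -- apply (is_deriveC_comp (fun y => snd (w y (- (s / 2)))) (fun y => y - s / 2) s 1); [apply Hv | exact Hshift].
           replace (s - s / 2) with (s / 2) by field. exact S2.
      * C_eq. replace (s - s / 2) with (s / 2) by field. field.
    + apply continuousC_mult; [apply continuousC_minus | apply continuousC_const];
        apply (Chalf _ (-1)); trivial; replace (-1 * (s / 2)) with (- (s / 2)) by ring; exact S2.
Qed.

Lemma continuous_square_sum (b : R) (P : R -> C) :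
  (forall s, - (2 * b) < s < 2 * b -> continuousC P s) ->
  continuous_square b (fun x t => P (x + t)).
Proof.
  intros HP x t [Hx Ht].
  apply (continuousC_comp (T := R2) (S := R_UniformSpace) (x, t) (fun p => fst p + snd p)).
  - apply continuous_Rplus; [apply continuous_fst_at | apply continuous_snd_at].
  - apply HP; simpl; lra.
Qed.

Lemma continuous_square_difference (b : R) (P : R -> C) :
  (forall s, - (2 * b) < s < 2 * b -> continuousC P s) ->
  continuous_square b (fun x t => P (x - t)).
Proof.
  intros HP x t [Hx Ht].
  apply (continuousC_comp (T := R2) (S := R_UniformSpace) (x, t) (fun p => fst p - snd p)).
  - apply (continuous_minus (V := R_NormedModule)); [apply continuous_fst_at | apply continuous_snd_at].
  - apply HP; simpl; lra.
Qed.

Lemma C1_square_wave (b : R) (P P1 Q Q1 : R -> C) (w : R -> R -> B) :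
  C1_profile b P P1 -> C1_profile b Q Q1 -> wave b P Q w ->
  C1_square b w (wave_fun P1 Q1) (wave_fun P1 (fun s => Copp (Q1 s))).
Proof.
  intros HP HQ Hw.
  assert (Hp : forall (x t : R), square b x t -> - (2 * b) < x + t < 2 * b) by (unfold square; intros; lra).
  assert (Hm : forall (x t : R), square b x t -> - (2 * b) < x - t < 2 * b) by (unfold square; intros; lra).
  assert (Cp := continuous_square_sum b P1 (fun s Hs => proj2 (HP s Hs))).
  assert (Cm := continuous_square_difference b Q1 (fun s Hs => proj2 (HQ s Hs))).
  assert (D : forall (F F1 : R -> C) (r : R -> R) (x d : R), is_derive r x d ->
    C1_profile b F F1 -> - (2 * b) < r x < 2 * b ->
    is_deriveC (fun y => F (r y)) x (Cmult (RtoC d) (F1 (r x)))).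
  { intros F F1 r x d Hr HF Hx. apply is_deriveC_comp; trivial. apply HF, Hx. }
  assert (Hlx : forall x t : R, square b x t -> locally x (fun y => square b y t)).
  { intros x t Hs. destruct (square_locally b x t Hs) as [e He]. exists e. intros y Hy.
    apply (He (y, t)). split; [exact Hy | apply ball_center]. }
  assert (Hlt : forall x t : R, square b x t -> locally t (fun y => square b x y)).
  { intros x t Hs. destruct (square_locally b x t Hs) as [e He]. exists e. intros y Hy.
    apply (He (x, y)). split; [apply ball_center | exact Hy]. }
  assert (Dx : forall x t, square b x t ->
    is_deriveC (fun y => P (y + t)) x (P1 (x + t)) /\ is_deriveC (fun y => Q (y - t)) x (Q1 (x - t))).
  { intros x t Hs. split.
    - rewrite <- (Cmult_1_l (P1 (x + t))).
      apply (D P P1 (fun y => y + t)); auto. auto_derive; trivial.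
    - rewrite <- (Cmult_1_l (Q1 (x - t))).
      apply (D Q Q1 (fun y => y - t)); auto. auto_derive; trivial. }
  assert (Dt : forall x t, square b x t ->
    is_deriveC (fun y => P (x + y)) t (P1 (x + t)) /\ is_deriveC (fun y => Q (x - y)) t (Copp (Q1 (x - t)))).
  { intros x t Hs. split.
    - rewrite <- (Cmult_1_l (P1 (x + t))).
      apply (D P P1 (fun y => x + y)); auto. auto_derive; trivial.
    - evar_last.
      + apply (D Q Q1 (fun y => x - y) t (Ropp 1)); auto. auto_derive; trivial; ring.
      + C_eq. rewrite RtoC_opp. ring. }
  apply C1_square_iff. split; apply C1_scalar_of_partials.
  - intros x t Hs. destruct (Dx x t Hs), (Dt x t Hs). split.
    + apply (is_derive_ext_loc (V := C_R_NormedModule) (fun y => Cplus (P (y + t)) (Q (y - t)))).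
      { generalize (Hlx x t Hs); apply filter_imp. intros y Hy. rewrite (Hw y t Hy). reflexivity. }
      apply is_deriveC_plus; assumption.
    + apply (is_derive_ext_loc (V := C_R_NormedModule) (fun y => Cplus (P (x + y)) (Q (x - y)))).
      { generalize (Hlt x t Hs); apply filter_imp. intros y Hy. rewrite (Hw x y Hy). reflexivity. }
      apply is_deriveC_plus; assumption.
  - intros x t Hs; apply continuousC_plus; [apply Cp | apply Cm]; exact Hs.
  - intros x t Hs; apply continuousC_plus; [apply Cp | apply continuousC_opp, Cm]; exact Hs.
  - intros x t Hs. destruct (Dx x t Hs), (Dt x t Hs). split.
    + apply (is_derive_ext_loc (V := C_R_NormedModule) (fun y => Cminus (P (y + t)) (Q (y - t)))).
      { generalize (Hlx x t Hs); apply filter_imp. intros y Hy. rewrite (Hw y t Hy). reflexivity. }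
      apply is_deriveC_minus; assumption.
    + apply (is_derive_ext_loc (V := C_R_NormedModule) (fun y => Cminus (P (x + y)) (Q (x - y)))).
      { generalize (Hlt x t Hs); apply filter_imp. intros y Hy. rewrite (Hw x y Hy). reflexivity. }
      apply is_deriveC_minus; assumption.
  - intros x t Hs; apply continuousC_minus; [apply Cp | apply Cm]; exact Hs.
  - intros x t Hs; apply continuousC_minus; [apply Cp | apply continuousC_opp, Cm]; exact Hs.
Qed.

Lemma C1_scalar_unique (b : R) (g gx gt gx' gt' : R -> R -> C) (x t : R) :
  C1_scalar b g gx gt -> C1_scalar b g gx' gt' -> square b x t ->
  gx x t = gx' x t /\ gt x t = gt' x t.
Proof.
  intros H1 H2 Hs. split.
  - apply (is_deriveC_unique (fun y => g y t) x); [apply (c1_x _ _ _ _ H1) | apply (c1_x _ _ _ _ H2)]; exact Hs.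
  - apply (is_deriveC_unique (fun y => g x y) t); [apply (c1_t _ _ _ _ H1) | apply (c1_t _ _ _ _ H2)]; exact Hs.
Qed.

Lemma is_dz_wave (b : R) (P P1 Q Q1 : R -> C) (w w' : R -> R -> B) :
  C1_profile b P P1 -> C1_profile b Q Q1 -> wave b P Q w ->
  (is_dz b w w' <-> wave b P1 Q1 w').
Proof.
  intros HP HQ Hw.
  assert (HC := C1_square_wave b P P1 Q Q1 w HP HQ Hw).
  assert (E : forall x t : R, (Bhalf * (wave_fun P1 Q1 x t + Bj * wave_fun P1 (fun s => Copp (Q1 s)) x t))%B
    = wave_fun P1 Q1 x t).
  { intros x t. unfold Bhalf, Bj, scalar, Bmult, Bplus, wave_fun; simpl.
    apply injective_projections; simpl; C_eq; field. }
  split.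
  - intros [wx [wt [HC' Hw']]] x t Hs. rewrite Hw' by exact Hs.
    destruct (proj1 (C1_square_iff _ _ _ _) HC) as [A1 A2].
    destruct (proj1 (C1_square_iff _ _ _ _) HC') as [B1 B2].
    destruct (C1_scalar_unique _ _ _ _ _ _ x t B1 A1 Hs) as [E1 E2].
    destruct (C1_scalar_unique _ _ _ _ _ _ x t B2 A2 Hs) as [E3 E4].
    rewrite (injective_projections _ _ E1 E3), (injective_projections _ _ E2 E4). apply E.
  - intros Hw'. do 2 eexists; split; [exact HC | ].
    intros x t Hs. rewrite (Hw' x t Hs). symmetry; apply E.
Qed.

Lemma C1_profile_of_is_dz (b : R) (P Q : R -> C) (w w' : R -> R -> B) :
  wave b P Q w -> is_dz b w w' -> exists P1 Q1, C1_profile b P P1 /\ C1_profile b Q Q1.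
Proof.
  intros Hw [wx [wt [HC _]]].
  destruct (proj1 (C1_square_iff _ _ _ _) HC) as [A1 A2].
  apply (wave_C1_profile b P Q w (fun x t => fst (wx x t)) (fun x t => snd (wx x t))); trivial.
  - apply (c1_x _ _ _ _ A1).
  - apply (c1_x _ _ _ _ A2).
  - apply (c1_cont_x _ _ _ _ A1).
  - apply (c1_cont_x _ _ _ _ A2).
Qed.

Lemma C1_scalar_plus (b : R) (g gx gt k kx kt : R -> R -> C) :
  C1_scalar b g gx gt -> C1_scalar b k kx kt ->
  C1_scalar b (fun x t => Cplus (g x t) (k x t))
    (fun x t => Cplus (gx x t) (kx x t)) (fun x t => Cplus (gt x t) (kt x t)).
Proof.
  intros [A1 A2 A3 A4 A5] [B1 B2 B3 B4 B5]. constructor; intros x t Hs;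
    (apply is_deriveC_plus || apply continuousC_plus); auto;
    apply A3 || apply A4 || apply A5 || apply B3 || apply B4 || apply B5; exact Hs.
Qed.

Lemma C1_scalar_minus (b : R) (g gx gt k kx kt : R -> R -> C) :
  C1_scalar b g gx gt -> C1_scalar b k kx kt ->
  C1_scalar b (fun x t => Cminus (g x t) (k x t))
    (fun x t => Cminus (gx x t) (kx x t)) (fun x t => Cminus (gt x t) (kt x t)).
Proof.
  intros [A1 A2 A3 A4 A5] [B1 B2 B3 B4 B5]. constructor; intros x t Hs;
    (apply is_deriveC_minus || apply continuousC_minus); auto;
    apply A3 || apply A4 || apply A5 || apply B3 || apply B4 || apply B5; exact Hs.
Qed.

Lemma Cmult_half_eq_0 (z : C) : Cmult (Cinv (RtoC 2)) z = RtoC 0 -> z = RtoC 0.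
Proof.
  intros E. replace z with (Cmult (RtoC 2) (Cmult (Cinv (RtoC 2)) z)) by field.
  rewrite E. ring.
Qed.

(** The Cauchy-Riemann system u_x = v_t, v_x = u_t decouples into transport equations for
    u + v and u - v. *)
Lemma hyperbolic_analytic_wave (b : R) (w : R -> R -> B) :
  hyperbolic_analytic b w ->
  exists P P1 Q Q1, C1_profile b P P1 /\ C1_profile b Q Q1 /\ wave b P Q w.
Proof.
  intros [wx [wt [HC Heq]]].
  destruct (proj1 (C1_square_iff _ _ _ _) HC) as [A1 A2].
  assert (CR : forall x t, square b x t ->
    fst (wx x t) = snd (wt x t) /\ snd (wx x t) = fst (wt x t)).
  { intros x t Hs. specialize (Heq x t Hs). symmetry in Heq.
    assert (E1 := f_equal fst Heq). assert (E2 := f_equal snd Heq). simpl in E1, E2.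
    assert (F1 : Cminus (fst (wx x t)) (snd (wt x t)) = RtoC 0).
    { apply Cmult_half_eq_0. etransitivity; [ | exact E1]. ring. }
    assert (F2 : Cminus (snd (wx x t)) (fst (wt x t)) = RtoC 0).
    { apply Cmult_half_eq_0. etransitivity; [ | exact E2]. ring. }
    split.
    - rewrite <- (Cplus_0_r (snd (wt x t))), <- F1. ring.
    - rewrite <- (Cplus_0_r (fst (wt x t))), <- F2. ring. }
  assert (Hp := C1_scalar_plus _ _ _ _ _ _ _ A1 A2).
  assert (Hm := C1_scalar_minus _ _ _ _ _ _ _ A1 A2).
  set (P := fun s => Cdiv (Cplus (fst (w (s / 2) (1 * (s / 2)))) (snd (w (s / 2) (1 * (s / 2))))) (RtoC 2)).
  set (Q := fun s => Cdiv (Cminus (fst (w (s / 2) (-1 * (s / 2)))) (snd (w (s / 2) (-1 * (s / 2))))) (RtoC 2)).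
  assert (Hw : wave b P Q w).
  { intros x t Hs.
    assert (E1 := transport_constant_on_characteristics b 1 _ _ _ x t (or_introl eq_refl) Hp).
    assert (E2 := transport_constant_on_characteristics b (-1) _ _ _ x t (or_intror eq_refl) Hm).
    cbv beta in E1, E2.
    replace (x + 1 * t) with (x + t) in E1 by ring. replace (x + -1 * t) with (x - t) in E2 by ring.
    unfold wave_fun, P, Q. rewrite <- E1, <- E2; trivial.
    - apply injective_projections; simpl; field.
    - intros y s Hys. destruct (CR y s Hys) as [-> ->]. 
      change (-1) with (Ropp 1). rewrite RtoC_opp. ring.
    - intros y s Hys. destruct (CR y s Hys) as [-> ->]. ring. }
  destruct (wave_C1_profile b P Q w (fun x t => fst (wx x t)) (fun x t => snd (wx x t))) as [P1 [Q1 [HP HQ]]]; trivial.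
  - apply (c1_x _ _ _ _ A1).
  - apply (c1_x _ _ _ _ A2).
  - apply (c1_cont_x _ _ _ _ A1).
  - apply (c1_cont_x _ _ _ _ A2).
  - exists P, P1, Q, Q1; auto.
Qed.

(** * Bers differentiation *)

(** One step of Bers differentiation with respect to the generating pair (e, j ei). Both
    parities of the step have this form, with (e, ei) = (f, 1/f) or (1/f, f). *)
Definition generating_step (b : R) (e ei : R -> C) (W W' : R -> R -> B) : Prop :=
  exists (phi psi : R -> R -> C) (phiz psiz : R -> R -> B),
    (forall x t, square b x t ->
       W x t = (scalar (phi x t) * scalar (e x) + scalar (psi x t) * (Bj * scalar (ei x)))%B) /\
    is_dz b (fun x t => scalar (phi x t)) phiz /\
    is_dz b (fun x t => scalar (psi x t)) psiz /\
    (forall x t, square b x t ->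
       W' x t = (phiz x t * scalar (e x) + psiz x t * (Bj * scalar (ei x)))%B).

Record reciprocal_pair (b : R) (a e ei : R -> C) : Prop := {
  rp_inv : forall x, -b < x < b -> Cmult (e x) (ei x) = RtoC 1;
  rp_e : forall x, -b < x < b -> is_deriveC e x (Cmult (a x) (e x));
  rp_ei : forall x, -b < x < b -> is_deriveC ei x (Copp (Cmult (a x) (ei x)));
  rp_a : forall x, -b < x < b -> continuousC a x
}.

Lemma reciprocal_pair_swap (b : R) (a e ei : R -> C) :
  reciprocal_pair b a e ei -> reciprocal_pair b (fun x => Copp (a x)) ei e.
Proof.
  intros [H1 H2 H3 H4]; constructor; intros x Hx.
  - rewrite Cmult_comm; auto.
  - evar_last; [apply H3, Hx | ]. C_eq; ring.
  - evar_last; [apply H2, Hx | ]. C_eq; ring.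
  - apply continuousC_opp, H4, Hx.
Qed.

Lemma continuous_square_fst (b : R) (r : R -> C) :
  (forall x, -b < x < b -> continuousC r x) -> continuous_square b (fun x _ => r x).
Proof.
  intros Hr x t [Hx _].
  apply (continuousC_comp (T := R2) (S := R_UniformSpace) (x, t) fst r); [apply continuous_fst_at | apply Hr, Hx].
Qed.

Lemma C1_scalar_mult_x (b : R) (r r1 : R -> C) (g gx gt : R -> R -> C) :
  (forall x, -b < x < b -> is_deriveC r x (r1 x)) ->
  (forall x, -b < x < b -> continuousC r1 x) ->
  C1_scalar b g gx gt ->
  C1_scalar b (fun x t => Cmult (g x t) (r x))
    (fun x t => Cplus (Cmult (gx x t) (r x)) (Cmult (g x t) (r1 x)))
    (fun x t => Cmult (gt x t) (r x)).
Proof.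
  intros Hr Cr1 [D1 D2 C0 C1 C2].
  assert (Cr := continuous_square_fst b r (fun x Hx => is_deriveC_continuous r x (r1 x) (Hr x Hx))).
  assert (Cr1' := continuous_square_fst b r1 Cr1).
  constructor; intros x t Hs.
  - exact (is_deriveC_mult (fun y => g y t) r x _ _ (D1 x t Hs) (Hr x (proj1 Hs))).
  - evar_last.
    + apply is_deriveC_mult; [apply D2, Hs | apply is_deriveC_const].
    + C_eq; ring.
  - apply continuousC_mult; [apply C0, Hs | apply Cr, Hs].
  - apply continuousC_plus; apply continuousC_mult;
      [apply C1, Hs | apply Cr, Hs | apply C0, Hs | apply Cr1', Hs].
  - apply continuousC_mult; [apply C2, Hs | apply Cr, Hs].
Qed.

Lemma continuous_square_ext (b : R) (g k : R -> R -> C) :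
  (forall x t, square b x t -> g x t = k x t) -> continuous_square b g -> continuous_square b k.
Proof.
  intros E Hg x t Hs.
  apply (continuous_ext_loc (T := R2) _ (fun p => g (fst p) (snd p))); [ | apply Hg, Hs].
  generalize (square_locally b x t Hs); apply filter_imp. intros p Hp; apply E, Hp.
Qed.

Lemma C1_scalar_ext (b : R) (g k gx gt kx kt : R -> R -> C) :
  (forall x t, square b x t -> g x t = k x t) ->
  (forall x t, square b x t -> gx x t = kx x t) ->
  (forall x t, square b x t -> gt x t = kt x t) ->
  C1_scalar b g gx gt -> C1_scalar b k kx kt.
Proof.
  intros E Ex Et [D1 D2 C0 C1 C2].
  constructor; [ | | exact (continuous_square_ext b g k E C0)
    | exact (continuous_square_ext b gx kx Ex C1) | exact (continuous_square_ext b gt kt Et C2)];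
    intros x t Hs; destruct (square_locally b x t Hs) as [e He].
  - rewrite <- Ex by exact Hs.
    apply (is_derive_ext_loc (V := C_R_NormedModule) (fun y => g y t)); [ | apply D1, Hs].
    exists e; intros y Hy. apply E, (He (y, t)). split; [exact Hy | apply ball_center].
  - rewrite <- Et by exact Hs.
    apply (is_derive_ext_loc (V := C_R_NormedModule) (fun y => g x y)); [ | apply D2, Hs].
    exists e; intros y Hy. apply E, (He (x, y)). split; [apply ball_center | exact Hy].
Qed.

Lemma C1_scalar_zero (b : R) :
  C1_scalar b (fun _ _ => RtoC 0) (fun _ _ => RtoC 0) (fun _ _ => RtoC 0).
Proof.
  constructor; intros x t Hs; try apply is_deriveC_const; apply continuousC_const.
Qed.

Lemma is_dz_scalar_iff (b : R) (phi : R -> R -> C) (phiz : R -> R -> B) :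
  is_dz b (fun x t => scalar (phi x t)) phiz <->
  exists phix phit, C1_scalar b phi phix phit /\
    forall x t, square b x t ->
      phiz x t = (Cdiv (phix x t) (RtoC 2), Cdiv (phit x t) (RtoC 2)).
Proof.
  split.
  - intros [wx [wt [HC Hz]]].
    destruct (proj1 (C1_square_iff _ _ _ _) HC) as [A1 A2]. simpl in A1, A2.
    do 2 eexists; split; [exact A1 | ]. intros x t Hs. rewrite Hz by exact Hs.
    destruct (C1_scalar_unique _ _ _ _ _ _ x t A2 (C1_scalar_zero b) Hs) as [E1 E2].
    unfold Bhalf, Bj, scalar, Bmult, Bplus; simpl. rewrite E1, E2.
    apply injective_projections; simpl; C_eq; field.
  - intros [phix [phit [HC Hz]]].
    exists (fun x t => scalar (phix x t)), (fun x t => scalar (phit x t)). split.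
    + apply C1_square_iff; simpl. split; [exact HC | apply C1_scalar_zero].
    + intros x t Hs. rewrite Hz by exact Hs.
      unfold Bhalf, Bj, scalar, Bmult, Bplus; simpl.
      apply injective_projections; simpl; C_eq; field.
Qed.

Section GeneratingStep.
Variables (b : R) (a e ei : R -> C).
Hypothesis RP : reciprocal_pair b a e ei.

Let De := rp_e _ _ _ _ RP.
Let Dei := rp_ei _ _ _ _ RP.

Lemma rp_cont_e1 : forall x, -b < x < b -> continuousC (fun x => Cmult (a x) (e x)) x.
Proof.
  intros x Hx. apply continuousC_mult; [apply (rp_a _ _ _ _ RP), Hx | ].
  exact (is_deriveC_continuous e x _ (De x Hx)).
Qed.

Lemma rp_cont_ei1 : forall x, -b < x < b -> continuousC (fun x => Copp (Cmult (a x) (ei x))) x.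
Proof.
  intros x Hx. apply continuousC_opp, continuousC_mult; [apply (rp_a _ _ _ _ RP), Hx | ].
  exact (is_deriveC_continuous ei x _ (Dei x Hx)).
Qed.

(** The coefficients of W are fst W / e and snd W / ei. Differentiating them and
    multiplying back leaves a first-order operator in W in which only a = e'/e is left. *)
Lemma generating_step_C1 (W W' : R -> R -> B) :
  generating_step b e ei W W' ->
  exists Ux Ut Vx Vt,
    C1_scalar b (fun x t => fst (W x t)) Ux Ut /\
    C1_scalar b (fun x t => snd (W x t)) Vx Vt /\
    forall x t, square b x t -> W' x t =
      (Cdiv (Cplus (Cminus (Ux x t) (Cmult (a x) (fst (W x t)))) (Vt x t)) (RtoC 2),
       Cdiv (Cplus (Ut x t) (Cplus (Vx x t) (Cmult (a x) (snd (W x t))))) (RtoC 2)).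
Proof.
  intros [phi [psi [phiz [psiz [HW [Hphi [Hpsi HW']]]]]]].
  apply is_dz_scalar_iff in Hphi. destruct Hphi as [phix [phit [Cphi Ephi]]].
  apply is_dz_scalar_iff in Hpsi. destruct Hpsi as [psix [psit [Cpsi Epsi]]].
  assert (CU := C1_scalar_mult_x b e _ phi phix phit De rp_cont_e1 Cphi).
  assert (CV := C1_scalar_mult_x b ei _ psi psix psit Dei rp_cont_ei1 Cpsi).
  do 4 eexists. split; [ | split].
  - apply (C1_scalar_ext b) with (4 := CU); try reflexivity.
    intros x t Hs. rewrite (HW x t Hs). unfold scalar, Bj, Bmult, Bplus; simpl. C_eq; ring.
  - apply (C1_scalar_ext b) with (4 := CV); try reflexivity.
    intros x t Hs. rewrite (HW x t Hs). unfold scalar, Bj, Bmult, Bplus; simpl. C_eq; ring.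
  - intros x t Hs. rewrite (HW' x t Hs), (HW x t Hs), Ephi, Epsi by exact Hs.
    unfold scalar, Bj, Bmult, Bplus; simpl.
    apply injective_projections; simpl; C_eq; field.
Qed.

Lemma generating_step_of_C1 (W W' : R -> R -> B) (Ux Ut Vx Vt : R -> R -> C) :
  C1_scalar b (fun x t => fst (W x t)) Ux Ut ->
  C1_scalar b (fun x t => snd (W x t)) Vx Vt ->
  (forall x t, square b x t -> W' x t =
      (Cdiv (Cplus (Cminus (Ux x t) (Cmult (a x) (fst (W x t)))) (Vt x t)) (RtoC 2),
       Cdiv (Cplus (Ut x t) (Cplus (Vx x t) (Cmult (a x) (snd (W x t))))) (RtoC 2))) ->
  generating_step b e ei W W'.
Proof.
  intros HU HV HW'.
  assert (CU := C1_scalar_mult_x b ei _ _ _ _ Dei rp_cont_ei1 HU).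
  assert (CV := C1_scalar_mult_x b e _ _ _ _ De rp_cont_e1 HV). cbv beta in CU, CV.
  do 4 eexists. split; [ | split; [apply is_dz_scalar_iff; do 2 eexists; split; [exact CU | reflexivity] |
    split; [apply is_dz_scalar_iff; do 2 eexists; split; [exact CV | reflexivity] | ]]].
  - intros x t Hs. assert (E := rp_inv _ _ _ _ RP x (proj1 Hs)).
    unfold scalar, Bj, Bmult, Bplus; simpl. apply injective_projections; simpl; C_eq.
    + transitivity (Cmult (fst (W x t)) (Cmult (e x) (ei x))); [rewrite E | ]; ring.
    + transitivity (Cmult (snd (W x t)) (Cmult (e x) (ei x))); [rewrite E | ]; ring.
  - intros x t Hs. assert (E := rp_inv _ _ _ _ RP x (proj1 Hs)).
    rewrite (HW' x t Hs).
    unfold scalar, Bj, Bmult, Bplus; simpl. apply injective_projections; simpl; C_eq.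
    + transitivity (Cmult (Cdiv (Cplus (Cminus (Ux x t) (Cmult (a x) (fst (W x t)))) (Vt x t)) (RtoC 2)) (Cmult (e x) (ei x)));
        [rewrite E; ring | field].
    + transitivity (Cmult (Cdiv (Cplus (Ut x t) (Cplus (Vx x t) (Cmult (a x) (snd (W x t))))) (RtoC 2)) (Cmult (e x) (ei x)));
        [rewrite E; ring | field].
Qed.

End GeneratingStep.

Lemma V_op_eq (H1 H2 : R -> R -> C) (w : R -> R -> B) (x t : R) :
  V_op H1 H2 w x t =
  (transmutation H1 (fun s => fst (w s t)) x, transmutation H2 (fun s => snd (w s t)) x).
Proof.
  unfold V_op, scalar, Bj, Bmult, Bplus, scalar_part, j_part.
  apply injective_projections; simpl; C_eq; ring.
Qed.

Lemma transmutation_ext (b : R) (H : R -> R -> C) (g1 g2 : R -> C) (x : R) :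
  -b < x < b -> (forall s, -b < s < b -> g1 s = g2 s) ->
  transmutation H g1 x = transmutation H g2 x.
Proof.
  intros Hx Hg. unfold transmutation. fold (kernel_RInt H g1 x) (kernel_RInt H g2 x).
  rewrite (Hg x Hx), (kernel_RInt_ext b H H g1 g2 x Hx); trivial.
Qed.

Lemma V_op_ext (b : R) (H1 H2 : R -> R -> C) (w1 w2 : R -> R -> B) (x t : R) :
  square b x t -> (forall y s, square b y s -> w1 y s = w2 y s) ->
  V_op H1 H2 w1 x t = V_op H1 H2 w2 x t.
Proof.
  intros [Hx Ht] Hw. rewrite !V_op_eq. f_equal; apply (transmutation_ext b); trivial;
    intros s Hs; rewrite Hw; trivial; split; assumption.
Qed.

Lemma continuous_square_wave (b : R) (P Q : R -> C) (w : R -> R -> B) :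
  (forall s, -(2 * b) < s < 2 * b -> continuousC P s) ->
  (forall s, -(2 * b) < s < 2 * b -> continuousC Q s) -> wave b P Q w ->
  continuous_square b (fun x t => fst (w x t)) /\ continuous_square b (fun x t => snd (w x t)).
Proof.
  intros HP HQ Hw.
  assert (Cp := continuous_square_sum b P HP).
  assert (Cm := continuous_square_difference b Q HQ).
  split; intros x t Hs.
  - apply (continuous_ext_loc (T := R2) _ (fun p => Cplus (P (fst p + snd p)) (Q (fst p - snd p)))).
    + generalize (square_locally b x t Hs); apply filter_imp. intros p Hp; rewrite (Hw _ _ Hp); reflexivity.
    + apply continuousC_plus; [apply Cp | apply Cm]; exact Hs.
  - apply (continuous_ext_loc (T := R2) _ (fun p => Cminus (P (fst p + snd p)) (Q (fst p - snd p)))).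
    + generalize (square_locally b x t Hs); apply filter_imp. intros p Hp; rewrite (Hw _ _ Hp); reflexivity.
    + apply continuousC_minus; [apply Cp | apply Cm]; exact Hs.
Qed.

Section BersStep.
Variables (b : R) (a a1 q p e ei : R -> C) (H Hu Hv M Mu Mv : R -> R -> C).
Hypothesis hb : 0 < b.
Hypothesis DP : darboux_pair b a a1 q p.
Hypothesis RH : regular_goursat b q (a 0) H Hu Hv.
Hypothesis RM : regular_goursat b p (Copp (a 0)) M Mu Mv.
Hypothesis RP : reciprocal_pair b a e ei.

(** The commutation relations for both components; u_t = v_x and v_t = u_x make the
    same two functions u1 and v1 appear in all four partial derivatives. *)
Lemma C1_scalar_V_op (P P1 Q Q1 : R -> C) (w : R -> R -> B) :
  C1_profile b P P1 -> C1_profile b Q Q1 -> wave b P Q w ->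
  let u1 := fun x t => transmutation M (fun s => fst (wave_fun P1 Q1 s t)) x in
  let v1 := fun x t => transmutation H (fun s => snd (wave_fun P1 Q1 s t)) x in
  C1_scalar b (fun x t => fst (V_op H M w x t))
    (fun x t => Cplus (Cmult (a x) (fst (V_op H M w x t))) (u1 x t)) v1 /\
  C1_scalar b (fun x t => snd (V_op H M w x t))
    (fun x t => Cminus (v1 x t) (Cmult (a x) (snd (V_op H M w x t)))) u1.
Proof.
  intros HP HQ Hw u1 v1.
  destruct (proj1 (C1_square_iff _ _ _ _) (C1_square_wave b P P1 Q Q1 w HP HQ Hw)) as [Cu Cv].
  assert (RH' : regular_goursat b q (Copp (Copp (a 0))) H Hu Hv).
  { replace (Copp (Copp (a 0))) with (a 0) by ring. exact RH. }
  assert (CU := C1_scalar_transmutation b a a1 q p H Hu Hv M Mu Mv _ _ _ hb DP RH RM Cu).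
  assert (CV := C1_scalar_transmutation b _ _ p q M Mu Mv H Hu Hv _ _ _ hb
    (darboux_pair_swap b a a1 q p DP) RM RH' Cv).
  split.
  - apply (C1_scalar_ext b) with (4 := CU); intros x t Hs; rewrite ?V_op_eq; reflexivity.
  - apply (C1_scalar_ext b) with (4 := CV); intros x t Hs; rewrite ?V_op_eq.
    + reflexivity.
    + unfold v1; simpl. ring.
    + apply (transmutation_ext b); [apply Hs | ]. intros s _. simpl. ring.
Qed.

Lemma generating_step_iff (P P1 Q Q1 : R -> C) (w w' W W' : R -> R -> B) :
  C1_profile b P P1 -> C1_profile b Q Q1 -> wave b P Q w -> wave b P1 Q1 w' ->
  (forall x t, square b x t -> V_op H M w x t = W x t) ->
  (generating_step b e ei W W' <-> forall x t, square b x t -> V_op M H w' x t = W' x t).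
Proof.
  intros HP HQ Hw Hw' HW.
  destruct (C1_scalar_V_op P P1 Q Q1 w HP HQ Hw) as [CU CV].
  assert (CU' := C1_scalar_ext b _ (fun x t => fst (W x t)) _ _ _ _
    (fun x t Hs => f_equal fst (HW x t Hs)) (fun _ _ _ => eq_refl) (fun _ _ _ => eq_refl) CU).
  assert (CV' := C1_scalar_ext b _ (fun x t => snd (W x t)) _ _ _ _
    (fun x t Hs => f_equal snd (HW x t Hs)) (fun _ _ _ => eq_refl) (fun _ _ _ => eq_refl) CV).
  clear CU CV.
  assert (E : forall x t, square b x t -> V_op M H w' x t =
    (transmutation M (fun s => fst (wave_fun P1 Q1 s t)) x,
     transmutation H (fun s => snd (wave_fun P1 Q1 s t)) x)).
  { intros x t Hs. rewrite (V_op_ext b M H w' (wave_fun P1 Q1) x t Hs); [apply V_op_eq | ].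
    intros y s Hys. apply Hw', Hys. }
  split.
  - intros Hstep x t Hs.
    destruct (generating_step_C1 b a e ei RP W W' Hstep) as [Ux [Ut [Vx [Vt [DU [DV E']]]]]].
    rewrite (E' x t Hs), (E x t Hs).
    destruct (C1_scalar_unique _ _ _ _ _ _ x t DU CU' Hs) as [-> ->].
    destruct (C1_scalar_unique _ _ _ _ _ _ x t DV CV' Hs) as [-> ->].
    rewrite (HW x t Hs). apply injective_projections; simpl; C_eq; field.
  - intros HW'. apply (generating_step_of_C1 b a e ei RP W W' _ _ _ _ CU' CV').
    intros x t Hs. rewrite <- (HW' x t Hs), (E x t Hs), (HW x t Hs).
    apply injective_projections; simpl; C_eq; field.
Qed.

(** The converse direction: a step of Bers differentiation gives W, hence by
    [derive_x_of_transmutation] w itself, a continuous x-derivative. *)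
Lemma C1_profile_of_generating_step (P Q : R -> C) (w W W' : R -> R -> B) :
  (forall s, -(2 * b) < s < 2 * b -> continuousC P s) ->
  (forall s, -(2 * b) < s < 2 * b -> continuousC Q s) -> wave b P Q w ->
  (forall x t, square b x t -> V_op H M w x t = W x t) ->
  generating_step b e ei W W' ->
  exists P1 Q1, C1_profile b P P1 /\ C1_profile b Q Q1.
Proof.
  intros HP HQ Hw HW Hstep.
  destruct (continuous_square_wave b P Q w HP HQ Hw) as [Cu Cv].
  destruct (generating_step_C1 b a e ei RP W W' Hstep) as [Ux [Ut [Vx [Vt [DU [DV _]]]]]].
  assert (DU' : C1_scalar b (fun x t => transmutation H (fun s => fst (w s t)) x) Ux Ut).
  { apply (C1_scalar_ext b) with (4 := DU); trivial.
    intros x t Hs. rewrite <- (HW x t Hs), V_op_eq. reflexivity. }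
  assert (DV' : C1_scalar b (fun x t => transmutation M (fun s => snd (w s t)) x) Vx Vt).
  { apply (C1_scalar_ext b) with (4 := DV); trivial.
    intros x t Hs. rewrite <- (HW x t Hs), V_op_eq. reflexivity. }
  destruct (derive_x_of_transmutation b q _ H Hu Hv (fun x t => fst (w x t)) Ux hb RH Cu
    (c1_x _ _ _ _ DU') (c1_cont_x _ _ _ _ DU')) as [ux [Dux Cux]].
  destruct (derive_x_of_transmutation b p _ M Mu Mv (fun x t => snd (w x t)) Vx hb RM Cv
    (c1_x _ _ _ _ DV') (c1_cont_x _ _ _ _ DV')) as [vx [Dvx Cvx]].
  exact (wave_C1_profile b P Q w ux vx Hw Dux Dvx Cux Cvx).
Qed.

End BersStep.

(** * The transmutation of z-derivatives into Bers derivatives *)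

(** At an interior point the filter restricted to the segment is the full one. *)
Lemma is_derive_in_interior (b : R) (g : R -> C) (x : R) (l : C) :
  -b < x < b -> is_derive_in (segment b) g x l -> is_deriveC g x l.
Proof.
  intros Hx [Hlin Hdom]. split; [exact Hlin | ].
  intros y Hy eps.
  assert (Hw : is_filter_lim (within (segment b) (locally x)) y).
  { intros D HD. unfold within. generalize (Hy D HD). apply filter_imp. auto. }
  assert (Hl : locally x (segment b)).
  { destruct (symmetric_interval_thick b x Hx) as [e He]. exists e. intros z Hz.
    assert (Hzb := proj1 (He z 0 Hz ltac:(pose proof (cond_pos e); unfold Rmin, Rmax; destruct Rle_dec; lra))).
    unfold segment; lra. }
  generalize (filter_and _ _ Hl (Hdom y Hw eps)). unfold within.
  apply filter_imp. intros z [H1 H2]; exact (H2 H1).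
Qed.

(** The operator that carries the z-derivative of order n to the Bers derivative of
    order n. *)
Definition V_parity (H1 H2 : R -> R -> C) (n : nat) : (R -> R -> B) -> R -> R -> B :=
  if Nat.even n then V_op H1 H2 else V_op H2 H1.

Section Bers.
Variables (b : R) (f f1 f2 : R -> C) (H Hu Hv M Mu Mv : R -> R -> C).
Hypothesis hb : 0 < b.
Hypothesis hf : C2_segment b f f1 f2.
Hypothesis hf_neq0 : forall x, segment b x -> f x <> RtoC 0.
Hypothesis hf0 : f 0 = RtoC 1.

Let a := fun x => Cdiv (f1 x) (f x).
Let a1 := fun x => Cminus (Cdiv (f2 x) (f x)) (Cmult (a x) (a x)).

Lemma interior_segment (x : R) : -b < x < b -> segment b x.
Proof. unfold segment; lra. Qed.

Lemma f_interior (x : R) : -b < x < b ->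
  f x <> RtoC 0 /\ is_deriveC f x (f1 x) /\ is_deriveC f1 x (f2 x) /\ continuousC f2 x.
Proof.
  intros Hx. destruct hf as [Hf [Hf1 Hf2]].
  assert (Hs := interior_segment x Hx). split; [ | split; [ | split]].
  - apply hf_neq0, Hs.
  - apply (is_derive_in_interior b); [exact Hx | apply Hf, Hs].
  - apply (is_derive_in_interior b); [exact Hx | apply Hf1, Hs].
  - apply (continuous_on_interior (segment b) f2 x Hf2).
    destruct (symmetric_interval_thick b x Hx) as [e He]. exists e. intros z Hz.
    apply interior_segment, (He z 0 Hz).
    pose proof (cond_pos e); unfold Rmin, Rmax; destruct Rle_dec; lra.
Qed.

Lemma continuousC_Cdiv_f (g : R -> C) (x : R) :
  -b < x < b -> continuousC g x -> continuousC (fun y => Cdiv (g y) (f y)) x.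
Proof.
  intros Hx Hg. destruct (f_interior x Hx) as [H0 [Hf _]].
  apply continuousC_mult; [exact Hg | ].
  exact (is_deriveC_continuous _ x _ (is_deriveC_inv f x (f1 x) Hf H0)).
Qed.

Lemma continuousC_log_derivative (x : R) : -b < x < b -> continuousC a x.
Proof.
  intros Hx. apply continuousC_Cdiv_f; [exact Hx | ].
  destruct (f_interior x Hx) as [_ [_ [Hf1 _]]]. exact (is_deriveC_continuous f1 x _ Hf1).
Qed.

Lemma continuousC_q_f (x : R) : -b < x < b -> continuousC (q_f f f2) x.
Proof. intros Hx. apply continuousC_Cdiv_f; [exact Hx | apply (f_interior x Hx)]. Qed.

Lemma continuousC_q_inv_f (x : R) : -b < x < b -> continuousC (q_inv_f f f1 f2) x.
Proof.
  intros Hx. assert (Ha := continuousC_log_derivative x Hx).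
  apply continuousC_plus; [apply continuousC_opp, continuousC_q_f, Hx | ].
  apply continuousC_mult; [apply continuousC_const | ].
  apply continuousC_mult; exact Ha.
Qed.

Lemma darboux_pair_f : darboux_pair b a a1 (q_f f f2) (q_inv_f f f1 f2).
Proof.
  constructor; intros x Hx.
  - destruct (f_interior x Hx) as [H0 [Hf [Hf1 _]]].
    evar_last.
    + apply is_deriveC_mult; [exact Hf1 | exact (is_deriveC_inv f x _ Hf H0)].
    + C_eq. unfold a1, a. field; exact H0.
  - assert (Ha := continuousC_log_derivative x Hx).
    apply continuousC_minus; [exact (continuousC_q_f x Hx) | ].
    apply continuousC_mult; exact Ha.
  - unfold q_f, a1. ring.
  - unfold q_inv_f, q_f, a1. fold (a x). ring.
Qed.

Lemma reciprocal_pair_f : reciprocal_pair b a f (fun x => Cinv (f x)).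
Proof.
  constructor; intros x Hx; destruct (f_interior x Hx) as [H0 [Hf _]].
  - field; exact H0.
  - evar_last; [exact Hf | ]. C_eq. unfold a. field; exact H0.
  - evar_last; [exact (is_deriveC_inv f x _ Hf H0) | ]. C_eq. unfold a. field; exact H0.
  - exact (continuousC_log_derivative x Hx).
Qed.

Lemma log_derivative_0 : a 0 = f1 0.
Proof. unfold a. rewrite hf0. field. Qed.

Hypothesis RH : regular_goursat b (q_f f f2) (a 0) H Hu Hv.
Hypothesis RM : regular_goursat b (q_inv_f f f1 f2) (Copp (a 0)) M Mu Mv.

Lemma regular_goursat_opp_opp : regular_goursat b (q_f f f2) (Copp (Copp (a 0))) H Hu Hv.
Proof. replace (Copp (Copp (a 0))) with (a 0) by ring. exact RH. Qed.

Lemma bers_step_iff (n : nat) (P P1 Q Q1 : R -> C) (v v' W W' : R -> R -> B) :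
  C1_profile b P P1 -> C1_profile b Q Q1 -> wave b P Q v -> wave b P1 Q1 v' ->
  (forall x t, square b x t -> V_parity H M n v x t = W x t) ->
  (is_bers_step b f n W W' <->
   forall x t, square b x t -> V_parity H M (S n) v' x t = W' x t).
Proof.
  unfold V_parity, is_bers_step, F_, G_. rewrite Nat.even_succ, <- Nat.negb_even.
  destruct (Nat.even n); simpl; intros HP HQ Hv1 Hv2 HW.
  - exact (generating_step_iff b a a1 _ _ _ _ H Hu Hv M Mu Mv hb darboux_pair_f RH RM
      reciprocal_pair_f P P1 Q Q1 v v' W W' HP HQ Hv1 Hv2 HW).
  - exact (generating_step_iff b _ _ _ _ _ _ M Mu Mv H Hu Hv hb
      (darboux_pair_swap _ _ _ _ _ darboux_pair_f) RM regular_goursat_opp_opp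
      (reciprocal_pair_swap _ _ _ _ reciprocal_pair_f) P P1 Q Q1 v v' W W' HP HQ Hv1 Hv2 HW).
Qed.

Lemma C1_profile_of_bers_step (n : nat) (P Q : R -> C) (v W W' : R -> R -> B) :
  (forall s, -(2 * b) < s < 2 * b -> continuousC P s) ->
  (forall s, -(2 * b) < s < 2 * b -> continuousC Q s) -> wave b P Q v ->
  (forall x t, square b x t -> V_parity H M n v x t = W x t) ->
  is_bers_step b f n W W' ->
  exists P1 Q1, C1_profile b P P1 /\ C1_profile b Q Q1.
Proof.
  unfold V_parity, is_bers_step, F_, G_.
  destruct (Nat.even n); simpl; intros HP HQ Hw HW Hstep.
  - exact (C1_profile_of_generating_step b a _ _ _ _ H Hu Hv M Mu Mv hb RH RM
      reciprocal_pair_f P Q v W W' HP HQ Hw HW Hstep).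
  - exact (C1_profile_of_generating_step b (fun x => Copp (a x)) _ _ _ _ M Mu Mv H Hu Hv hb RM regular_goursat_opp_opp
      (reciprocal_pair_swap _ _ _ _ reciprocal_pair_f) P Q v W W' HP HQ Hw HW Hstep).
Qed.

Lemma vekua_solution_V_op (w : R -> R -> B) :
  hyperbolic_analytic b w -> vekua_solution b f f1 (V_op H M w).
Proof.
  intros Hw. destruct (hyperbolic_analytic_wave b w Hw) as [P [P1 [Q [Q1 [HP [HQ HPQ]]]]]].
  destruct (C1_scalar_V_op b a a1 _ _ H Hu Hv M Mu Mv hb darboux_pair_f RH RM
    P P1 Q Q1 w HP HQ HPQ) as [CU CV].
  set (u1 := fun x t => transmutation M (fun s => fst (wave_fun P1 Q1 s t)) x) in *.
  set (v1 := fun x t => transmutation H (fun s => snd (wave_fun P1 Q1 s t)) x) in *.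
  cbv zeta in CU, CV.
  set (Wx := fun x t => (Cplus (Cmult (a x) (fst (V_op H M w x t))) (u1 x t),
                         Cminus (v1 x t) (Cmult (a x) (snd (V_op H M w x t)))) : B).
  set (Wt := fun x t => (v1 x t, u1 x t) : B).
  exists (fun x t => Bhalf * (Wx x t - Bj * Wt x t))%B. split.
  - exists Wx, Wt. split; [ | reflexivity]. apply C1_square_iff. split; [exact CU | exact CV].
  - intros x t Hs. destruct (f_interior x (proj1 Hs)) as [H0 _].
    unfold Bhalf, Bj, Bconj, scalar, Bmult, Bplus, Bopp, Wx, Wt, a; simpl.
    apply injective_projections; simpl; C_eq; field; exact H0.
Qed.

(** The induction carries along that every z-derivative is a pair of travelling waves
    with continuous profiles. That is all that is known of the last derivative, and
    just enough for [C1_profile_of_bers_step] to apply to it. *)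
Lemma dz_bers_correspondence (w : R -> R -> B) (n : nat) :
  hyperbolic_analytic b w ->
  (forall wn, is_dz_n b n w wn -> exists P Q,
     (forall s, -(2 * b) < s < 2 * b -> continuousC P s) /\
     (forall s, -(2 * b) < s < 2 * b -> continuousC Q s) /\ wave b P Q wn) /\
  (forall wn Wn, is_dz_n b n w wn -> is_bers_n b f n (V_op H M w) Wn ->
     forall x t, square b x t -> V_parity H M n wn x t = Wn x t) /\
  ((exists wn, is_dz_n b n w wn) <-> (exists Wn, is_bers_n b f n (V_op H M w) Wn)).
Proof.
  intros Hw. induction n as [ | n [IHw [IHW IHex]]].
  - destruct (hyperbolic_analytic_wave b w Hw) as [P [P1 [Q [Q1 [HP [HQ HPQ]]]]]].
    split; [ | split].
    + intros wn Hwn. exists P, Q. split; [ | split].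
      * intros s Hs. exact (is_deriveC_continuous P s _ (proj1 (HP s Hs))).
      * intros s Hs. exact (is_deriveC_continuous Q s _ (proj1 (HQ s Hs))).
      * intros x t Hs. rewrite (Hwn x t Hs). apply HPQ, Hs.
    + intros wn Wn Hwn HWn x t Hs. rewrite (HWn x t Hs).
      apply (V_op_ext b); trivial.
    + split; intros _; eexists; intros x t _; reflexivity.
  - assert (Hstep : forall v, is_dz_n b n w v -> exists P Q, 
      (forall s, -(2 * b) < s < 2 * b -> continuousC P s) /\
      (forall s, -(2 * b) < s < 2 * b -> continuousC Q s) /\ wave b P Q v /\
      forall v', is_dz b v v' -> exists P1 Q1, C1_profile b P P1 /\ C1_profile b Q Q1 /\ wave b P1 Q1 v').
    { intros v Hv'. destruct (IHw v Hv') as [P [Q [CP [CQ HPQ]]]].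
      exists P, Q. split; [ | split; [ | split]]; trivial. intros v' Hdz.
      destruct (C1_profile_of_is_dz b P Q v v' HPQ Hdz) as [P1 [Q1 [HP HQ]]].
      exists P1, Q1. split; [ | split]; trivial. apply (is_dz_wave b P P1 Q Q1 v v'); assumption. }
    split; [ | split; [ | split]].
    + intros wn [v [Hv' Hdz]]. destruct (Hstep v Hv') as [P [Q [_ [_ [_ Hd]]]]].
      destruct (Hd wn Hdz) as [P1 [Q1 [HP [HQ Hwave]]]].
      exists P1, Q1. split; [ | split]; trivial.
      * intros s Hs; apply HP, Hs.
      * intros s Hs; apply HQ, Hs.
    + intros wn Wn [v [Hv' Hdz]] [V [HV HVW]].
      destruct (Hstep v Hv') as [P [Q [_ [_ [Hwv Hd]]]]].
      destruct (Hd wn Hdz) as [P1 [Q1 [HP [HQ Hwave]]]].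
      apply (bers_step_iff n P P1 Q Q1 v wn V Wn HP HQ Hwv Hwave); trivial.
      exact (IHW v V Hv' HV).
    + intros [wn [v [Hv' Hdz]]].
      destruct (proj1 IHex (ex_intro _ v Hv')) as [V HV].
      destruct (Hstep v Hv') as [P [Q [_ [_ [Hwv Hd]]]]].
      destruct (Hd wn Hdz) as [P1 [Q1 [HP [HQ Hwave]]]].
      exists (V_parity H M (S n) wn), V. split; trivial.
      apply (bers_step_iff n P P1 Q Q1 v wn V _ HP HQ Hwv Hwave); trivial.
      exact (IHW v V Hv' HV).
    + intros [Wn [V [HV HVW]]].
      destruct (proj2 IHex (ex_intro _ V HV)) as [v Hv'].
      destruct (IHw v Hv') as [P [Q [CP [CQ Hwv]]]].
      destruct (C1_profile_of_bers_step n P Q v V Wn CP CQ Hwv (IHW v V Hv' HV) HVW) as [P1 [Q1 [HP HQ]]].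
      exists (wave_fun P1 Q1), v. split; trivial.
      apply (is_dz_wave b P P1 Q Q1 v _ HP HQ Hwv). intros x t _; reflexivity.
Qed.

End Bers.
Theorem proposition5p3
  (b : R) (hb : 0 < b)
  (f f1 f2 : R -> C)
  (hf : C2_segment b f f1 f2)
  (hf_neq0 : forall x, segment b x -> f x <> RtoC 0)
  (hf0 : f 0 = RtoC 1)
  (H_f H_inv_f : R -> R -> C)
  (hH_f : is_goursat_solution b (q_f f f2) (f1 0) H_f)
  (hH_inv_f : is_goursat_solution b (q_inv_f f f1 f2) (Copp (f1 0)) H_inv_f)
  (w : R -> R -> B)
  (hw : hyperbolic_analytic b w) :
  let V1 := V_op H_f H_inv_f in
  let V2 := V_op H_inv_f H_f in
  let W := V1 w in
  vekua_solution b f f1 W /\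
  (forall n : nat, (1 <= n)%nat ->
     ((exists wn, is_dz_n b n w wn) <-> (exists Wn, is_bers_n b f n W Wn))) /\
  (forall (n : nat) (wn Wn : R -> R -> B), (1 <= n)%nat ->
     is_dz_n b (2 * n) w wn -> is_bers_n b f (2 * n) W Wn ->
     forall x t, square b x t -> V1 wn x t = Wn x t) /\
  (forall (n : nat) (wn Wn : R -> R -> B), (1 <= n)%nat ->
     is_dz_n b (2 * n - 1) w wn -> is_bers_n b f (2 * n - 1) W Wn ->
     forall x t, square b x t -> V2 wn x t = Wn x t).
Proof.
  intros V1 V2 W.
  rewrite <- (log_derivative_0 f f1 hf0) in hH_f, hH_inv_f.
  destruct (goursat_solution_regular b hb _ _ _ (continuousC_q_f b f f1 f2 hf hf_neq0) hH_f)
    as [Hu [Hv RH]].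
  destruct (goursat_solution_regular b hb _ _ _ (continuousC_q_inv_f b f f1 f2 hf hf_neq0) hH_inv_f)
    as [Mu [Mv RM]].
  assert (Hcor := fun n => dz_bers_correspondence b f f1 f2 _ Hu Hv _ Mu Mv hb hf hf_neq0 RH RM w n hw).
  split; [ | split; [ | split]].
  - exact (vekua_solution_V_op b f f1 f2 _ Hu Hv _ Mu Mv hb hf hf_neq0 RH RM w hw).
  - intros n _. apply Hcor.
  - intros n wn Wn _ Hdz Hbers x t Hs.
    rewrite <- (proj1 (proj2 (Hcor (2 * n)%nat)) wn Wn Hdz Hbers x t Hs).
    unfold V_parity. rewrite Nat.even_even. reflexivity.
  - intros n wn Wn Hn Hdz Hbers x t Hs.
    rewrite <- (proj1 (proj2 (Hcor (2 * n - 1)%nat)) wn Wn Hdz Hbers x t Hs).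
    unfold V_parity. rewrite Nat.even_sub, Nat.even_even by lia. reflexivity.
Qed.
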